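(* Let $\mathbb{F}_q$ be a finite field with $q$ elements of odd characteristic, let $Q$ be a non-degenerate quadratic form on $\mathbb{F}_q^3$, and let $\mathcal{S}^2_\times=\{\boldsymbol{\xi}\in\mathbb{F}_q^3: Q(\boldsymbol{\xi})=0\}\setminus\{\boldsymbol{0}\}$, equipped with its normalized counting measure $\sigma$. Then for every function $f:\mathcal{S}^2_\times\to\mathbb{C}$, $$\|(f\sigma)^{\vee}\|^4_{L^4(\mathbb{F}_q^3,d\boldsymbol{x})}\leq \frac{q^3}{|\mathcal{S}^2_\times|^2}\left(q+1-\frac{3q-4}{|\mathcal{S}^2_\times|}\right)\|f\|^4_{L^2(\mathcal{S}^2_\times,d\sigma)}.$$ This inequality is sharp (the constant on the right-hand side cannot be replaced by a smaller one), and equality holds if $f$ is a constant function. Moreover, any maximizer $f$ of this inequality has constant modulus, i.e. $|f|$ is constant on $\mathcal{S}^2_\times$.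
   Context: A quadratic form on $\mathbb{F}_q^3$ is written $Q(\boldsymbol{\xi})=\sum_{i,k=1}^3 a_{ik}\xi_i\xi_k$ with $a_{ik}=a_{ki}\in\mathbb{F}_q$. It is non-degenerate if the symmetric matrix $(a_{ik})$ is invertible. Fix a non-principal (nontrivial) additive character $\chi:\mathbb{F}_q\to\{z\in\mathbb{C}:|z|=1\}$. For a nonempty finite set $\mathcal{S}\subset\mathbb{F}_q^3$ and $f:\mathcal{S}\to\mathbb{C}$, define for $\boldsymbol{x}\in\mathbb{F}_q^3$ $$(f\sigma)^\vee(\boldsymbol{x})=\frac{1}{|\mathcal{S}|}\sum_{\boldsymbol{\xi}\in\mathcal{S}}f(\boldsymbol{\xi})\chi(\boldsymbol{\xi}\cdot\boldsymbol{x}),\qquad \boldsymbol{\xi}\cdot\boldsymbol{x}=\xi_1x_1+\xi_2x_2+\xi_3x_3.$$ Norms: $d\boldsymbol{x}$ is counting measure, so $\|g\|_{L^4(\mathbb{F}_q^3,d\boldsymbol{x})}^4=\sum_{\boldsymbol{x}\in\mathbb{F}_q^3}|g(\boldsymbol{x})|^4$; $\sigma$ is normalized counting measure on $\mathcal{S}$, so $\|f\|_{L^2(\mathcal{S},d\sigma)}^2=\frac{1}{|\mathcal{S}|}\sum_{\boldsymbol{\xi}\in\mathcal{S}}|f(\boldsymbol{\xi})|^2$. $|\cdot|$ of a set denotes cardinality. A maximizer is a nonzero function $f$ for which equality holds. *)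

(* Defs.v *)
From HB Require Import structures.
From mathcomp Require Import all_boot all_order all_algebra.
From mathcomp Require Import reals complex.

Set Implicit Arguments.
Unset Strict Implicit.
Unset Printing Implicit Defensive.

Import Order.TTheory GRing.Theory Num.Theory.
Local Open Scope ring_scope.
Local Open Scope complex_scope.

Section QuadraticForm.
Variable F : finFieldType.
Implicit Types (A : 'M[F]_3) (x y : 'rV[F]_3).

Definition quadform A x : F := \sum_(i < 3) \sum_(k < 3) A i k * x 0 i * x 0 k.

Definition dotp x y : F := \sum_(i < 3) x 0 i * y 0 i.

Definition cone A : {set 'rV[F]_3} :=
  [set x | quadform A x == 0] :\ 0.

End QuadraticForm.

Section Extension.
Variables (R : realType) (F : finFieldType).

Definition nontrivial_character (chi : F -> R[i]) : Prop :=
  [/\ forall a b, chi (a + b) = chi a * chi b,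
      forall a, `|chi a| = 1
    & exists a, chi a != 1].

Definition extension (chi : F -> R[i]) (S : {set 'rV[F]_3})
    (f : {x | x \in S} -> R[i]) (x : 'rV[F]_3) : R[i] :=
  #|S|%:R^-1 * \sum_(xi : {x | x \in S}) f xi * chi (dotp (val xi) x).

(* Norms take values in R[i]: they are nonnegative reals there, since [n.-root]
   of a nonnegative real is its nonnegative real root. *)
Definition L4norm (g : 'rV[F]_3 -> R[i]) : R[i] :=
  4.-root (\sum_(x : 'rV[F]_3) `|g x| ^+ 4).

Definition L2norm (S : {set 'rV[F]_3}) (f : {x | x \in S} -> R[i]) : R[i] :=
  2.-root (#|S|%:R^-1 * \sum_(xi : {x | x \in S}) `|f xi| ^+ 2).

Definition cone_constant (A : 'M[F]_3) : R :=
  let q : R := #|F|%:R in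
  let s : R := #|cone A|%:R in
  q ^+ 3 / s ^+ 2 * (q + 1 - (3 * q - 4) / s).

Definition maximizer (chi : F -> R[i]) (A : 'M[F]_3)
    (f : {x | x \in cone A} -> R[i]) : Prop :=
  (exists xi, f xi != 0) /\
  L4norm (extension chi f) ^+ 4 = (cone_constant A)%:C * L2norm f ^+ 4.

End Extension.

(* Main.v *)
(* Expanding the fourth power and using Parseval, the L4 norm becomes the additive
   energy E(f) = sum over x1 + x2 = x3 + x4 in the cone of f1 f2 (f3 f4)^*, and one
   may replace f by |f|.  Write F = f^2, N = sum F and s = q^2 - 1, the size of the
   cone.  Split E according to w = x1 + x2.
   For w = 0 the contribution is A^2 with A = sum f(x) f(-x); for w in the cone, x1
   and x2 lie on the line of w, and Cauchy-Schwarz gives (q - 2) (S - M) with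
   S = sum F F' over collinear pairs and M = sum F(x) F(-x).  Otherwise x1 and x2 are
   not orthogonal, and this part is at most q (N^2 - S).  The number of ways to write
   w as x1 + x2 is q - 1 or q + 1, so plain Cauchy-Schwarz is not sharp there:
   instead f1 f2 f3 f4 is bounded by AM-GM averaged over the three pairings {12|34},
   {13|24}, {14|23}, with weights depending on the quadratic characters of the inner
   products (x1,x2), (x1,x3), (x1,x4) so chosen that every non-orthogonal pair gets
   the same total weight.
   Finally (q + 1) S >= N^2, A^2 <= s M and A <= N; equality in the last two forces
   f to be even with f(x) f(-x) constant, hence f constant. *)

Require Import Defs.
From HB Require Import structures.
From mathcomp Require Import all_boot all_order all_algebra.
From mathcomp Require Import reals complex.
From mathcomp Require Import ring lra.

Set Implicit Arguments.
Unset Strict Implicit.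
Unset Printing Implicit Defensive.

Import Order.TTheory GRing.Theory Num.Theory.
Local Open Scope ring_scope.
Local Open Scope complex_scope.

(** * The quadratic character *)

Section QuadraticCharacter.
Variables (R : realFieldType) (F : finFieldType).
Implicit Types x y z a b : F.

(* A square has two roots, [0] one and a non-square none, so this is the
   quadratic character extended by [0] at [0]. *)
Definition qchar x : R := #|[set z | z ^+ 2 == x]|%:R - 1.

Lemma sum_indicator (T : finType) (p : pred T) : \sum_x (p x)%:R = #|p|%:R :> R.
Proof. by rewrite -sum1_card natr_sum [RHS]big_mkcond; apply: eq_bigr => x _; rewrite mulrb. Qed.

Lemma qcharE x : qchar x = \sum_z (z ^+ 2 == x)%:R - 1.
Proof.
rewrite sum_indicator /qchar; congr (_%:R - 1).
by apply: eq_card => z; rewrite inE.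
Qed.

Lemma sum_qchar : \sum_x qchar x = 0.
Proof.
under eq_bigr => x _ do rewrite qcharE.
rewrite sumrB exchange_big /= sumr_const.
rewrite (eq_bigr (fun=> 1)) ?sumr_const ?subrr // => z _.
rewrite (bigD1 (z ^+ 2)) //= eqxx big1 ?addr0 // => x /negPf hx.
by rewrite eq_sym hx.
Qed.

Lemma qchar0 : qchar 0 = 0.
Proof.
rewrite /qchar (_ : [set _ | _] = [set 0]) ?cards1 ?subrr //.
by apply/setP=> z; rewrite !inE sqrf_eq0.
Qed.

Lemma qcharMsq s x : s != 0 -> qchar (s ^+ 2 * x) = qchar x.
Proof.
move=> s0; rewrite !qcharE; congr (_ - 1).
rewrite (reindex_onto (fun z => s * z) (fun z => s^-1 * z)) /=; last first.
  by move=> z _; rewrite mulrA divff // mul1r.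
apply: eq_big => [z|z _]; first by rewrite mulrA mulVf // mul1r eqxx.
by rewrite exprMn (inj_eq (mulfI _)) // expf_neq0.
Qed.

Hypothesis charF : 2%N \notin [pchar F].

Lemma two_neq0 : 2 != 0 :> F.
Proof. by move: charF; rewrite inE /=. Qed.

Lemma qchar1 : qchar 1 = 1.
Proof.
rewrite /qchar (_ : [set _ | _] = [set 1; -1]); last first.
  by apply/setP=> z; rewrite !inE sqrf_eq1.
rewrite cards2 (_ : (1 != -1) = true) ?mulr2n ?addrK //.
by rewrite -subr_eq0 opprK -mulr2n two_neq0.
Qed.

Lemma qchar_sq s : s != 0 -> qchar (s ^+ 2) = 1.
Proof. by move=> s0; rewrite -[s ^+ 2]mulr1 qcharMsq // qchar1. Qed.

Lemma qcharP x : x != 0 ->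
  (qchar x = 1 /\ exists2 s, s != 0 & x = s ^+ 2) \/ qchar x = -1.
Proof.
move=> x0; case: (set_0Vmem [set z | z ^+ 2 == x]) => [hs|[s]].
  by right; rewrite /qchar hs cards0 sub0r.
rewrite inE => /eqP hs; left.
have s0 : s != 0 by apply: contraNneq x0 => s0; rewrite -hs s0 expr0n.
by split; [rewrite -hs qchar_sq | exists s].
Qed.

Lemma qcharM x y : qchar (x * y) = qchar x * qchar y.
Proof.
have [->|x0] := eqVneq x 0; first by rewrite !(mul0r, qchar0).
case: (qcharP x0) => [[-> [s s0 ->]]|hx]; first by rewrite qcharMsq // mul1r.
rewrite hx mulN1r.
(* For a non-square [x], the terms [-(qchar (x * z) + qchar z)] are nonnegative and
   sum to [0], so they all vanish. *)
have le0 z : 0 <= - (qchar (x * z) + qchar z).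
  have [->|z0] := eqVneq z 0; first by rewrite !(mulr0, qchar0, addr0, oppr0).
  case: (qcharP z0) => [[-> [s s0 ->]]|->]; first by rewrite mulrC qcharMsq // hx addNr oppr0.
  have /qcharP[[-> _]|->] : x * z != 0 by rewrite mulf_neq0.
    by rewrite subrr oppr0.
  by rewrite opprD opprK addr_ge0.
have sum0 : \sum_z - (qchar (x * z) + qchar z) = 0.
  rewrite sumrN big_split /= sum_qchar addr0.
  rewrite -[RHS]oppr0 -[in RHS]sum_qchar; congr (- _).
  rewrite [RHS](reindex_onto (fun z => x * z) (fun z => x^-1 * z)) /=; last first.
    by move=> z _; rewrite mulrA divff // mul1r.
  by apply: eq_bigl => z; rewrite mulrA mulVf // mul1r eqxx.
have /eqP : - (qchar (x * y) + qchar y) = 0 by apply: (psumr_eq0P _ sum0) => // z _; exact: le0.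
by rewrite oppr_eq0 addr_eq0 => /eqP.
Qed.

Lemma qchar_sqr x : qchar x ^+ 2 = (x != 0)%:R.
Proof.
have [->|x0] := eqVneq x 0; first by rewrite qchar0 expr0n.
by case: (qcharP x0) => [[-> _]|->]; rewrite ?sqrrN expr1n.
Qed.

Lemma sum_reflect (V : finZmodType) (h : V -> R) (v : V) :
  \sum_u h (v - u) = \sum_u h u.
Proof.
rewrite [RHS](reindex_onto (fun u => v - u) (fun u => v - u)) /=.
  by apply: eq_bigl => u; rewrite subKr eqxx.
by move=> u _; rewrite subKr.
Qed.

(** [qchar b ^+ 2] is the indicator of [b != 0], so this is the vanishing full sum without its term
    at [b = 0]. *)
Lemma sum_qchar_sqr_sub a : \sum_b qchar b ^+ 2 * qchar (a - b) = - qchar a.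
Proof.
have := sum_reflect qchar a; rewrite sum_qchar (bigD1 0) //= subr0.
move=> /eqP; rewrite addrC addr_eq0 => /eqP <-.
rewrite (bigD1 0) //= qchar0 expr0n mul0r add0r; apply: eq_bigr => b b0.
by rewrite qchar_sqr b0 mul1r.
Qed.

Lemma sum_qchar_sub_sqr a : \sum_b qchar b * qchar (a - b) ^+ 2 = - qchar a.
Proof.
rewrite -sum_qchar_sqr_sub -[RHS](sum_reflect _ a); apply: eq_bigr => b _.
by rewrite subKr mulrC.
Qed.

(** A Jacobi sum: for [b != 0], division by [b ^+ 2] turns the term into [qchar (a / b - 1)], and
    [a / b - 1] takes every value but [-1] exactly once. *)
Lemma sum_qchar_mul_sub a : a != 0 ->
  \sum_b qchar b * qchar (a - b) = - qchar (-1).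
Proof.
move=> a0; rewrite (bigD1 0) //= qchar0 mul0r add0r.
have -> : - qchar (-1) = \sum_(x | x != -1) qchar x.
  have := sum_qchar; rewrite (bigD1 (-1)) //= => /eqP.
  by rewrite addr_eq0 => /eqP ->; rewrite opprK.
rewrite [RHS](reindex_onto (fun b => a / b - 1) (fun x => a / (x + 1))) /=; last first.
  move=> x; rewrite -addr_eq0 => hx; by rewrite invfM invrK mulrA divff // mul1r addrK.
apply: eq_big => [b|b b0].
  rewrite subrK; have [->|b0] := eqVneq b 0; first by rewrite invr0 mulr0 sub0r eqxx.
  by rewrite -addr_eq0 subrK mulf_neq0 ?invr_eq0 //= invfM invrK mulrA divff // mul1r eqxx.
by rewrite -qcharM -(qcharMsq (a / b - 1) b0); congr qchar; field.
Qed.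
End QuadraticCharacter.

(** * Frames adapted to the cone *)

Section Cone.
Variables (F : finFieldType) (A : 'M[F]_3).
Hypotheses (charF : 2%N \notin [pchar F]) (symA : A^T = A) (ndA : A \in unitmx).
Implicit Types (u v w e f : 'rV[F]_3) (a b c x y z : F).

Definition bil u v : F := (u *m A *m v^T) 0 0.

Lemma quadformE v : quadform A v = bil v v.
Proof.
rewrite /bil mxE /quadform exchange_big /=; apply: eq_bigr => k _.
rewrite !mxE mulr_suml; apply: eq_bigr => i _; ring.
Qed.

Lemma bilC u v : bil u v = bil v u.
Proof.
rewrite /bil -[in LHS](trmxK (u *m A *m v^T)) mxE.
by rewrite !trmx_mul trmxK symA mulmxA.
Qed.

Lemma bilDl u v w : bil (u + v) w = bil u w + bil v w.
Proof. by rewrite /bil !mulmxDl mxE. Qed.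

Lemma bilZl a u v : bil (a *: u) v = a * bil u v.
Proof. by rewrite /bil -!scalemxAl mxE. Qed.

Lemma bilNl u v : bil (- u) v = - bil u v.
Proof. by rewrite -scaleN1r bilZl mulN1r. Qed.

Lemma bilDr u v w : bil u (v + w) = bil u v + bil u w.
Proof. by rewrite !(bilC u) bilDl. Qed.

Lemma bilZr a u v : bil u (a *: v) = a * bil u v.
Proof. by rewrite !(bilC u) bilZl. Qed.

Lemma bilNr u v : bil u (- v) = - bil u v.
Proof. by rewrite !(bilC u) bilNl. Qed.

Definition bilE := (bilDl, bilDr, bilZl, bilZr, bilNl, bilNr).

Lemma bil0l v : bil 0 v = 0.
Proof. by rewrite -(scale0r (0 : 'rV[F]_3)) bilZl mul0r. Qed.

Lemma bil0r v : bil v 0 = 0.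
Proof. by rewrite bilC bil0l. Qed.

Lemma bil_nondeg u : (forall v, bil u v = 0) -> u = 0.
Proof.
move=> hu; rewrite -(mulmxK ndA u); suff -> : u *m A = 0 by rewrite mul0mx.
apply/rowP=> i; rewrite [RHS]mxE -(hu (delta_mx 0 i)) /bil trmx_delta.
by rewrite -colE [RHS]mxE.
Qed.

Lemma in_cone v : (v \in cone A) = (v != 0) && (bil v v == 0).
Proof. by rewrite !inE quadformE. Qed.

Lemma cone_neq0 v : v \in cone A -> v != 0.
Proof. by rewrite in_cone => /andP[]. Qed.

Lemma cone_bil v : v \in cone A -> bil v v = 0.
Proof. by rewrite in_cone => /andP[_ /eqP]. Qed.

Lemma coneZ a v : a != 0 -> (a *: v \in cone A) = (v \in cone A).
Proof. by move=> a0; rewrite !in_cone scaler_eq0 (negPf a0) !bilE !mulf_eq0 (negPf a0). Qed.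

Lemma coneN v : (- v \in cone A) = (v \in cone A).
Proof. by rewrite -scaleN1r coneZ // oppr_eq0 oner_neq0. Qed.

(** Two linear conditions on a space of dimension three have a nonzero common solution; [u] and [v]
    may coincide. *)
Lemma orthogonal_exists u v : exists2 w, w != 0 & bil u w = 0 /\ bil v w = 0.
Proof.
pose M : 'M[F]_(3, 1 + 1) := A *m row_mx u^T v^T.
have : kermx M != 0.
  rewrite -mxrank_eq0 mxrank_ker subn_eq0 -ltnNge ltnS.
  exact: leq_trans (rank_leq_col _) _.
case/rowV0Pn=> w /sub_kermxP; rewrite /M mulmxA => hw w0; exists w => //.
move: hw; rewrite mul_mx_row => /eqP.
rewrite -[0]row_mx0 => /eqP /eq_row_mx [hu hv].
by rewrite !(bilC _ w) /bil hu hv mxE.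
Qed.

(** A hyperbolic pair and a vector orthogonal to it: in these coordinates the form is
    [2 * bil e f * x * y + bil w w * z ^+ 2]. *)
Definition frame e f w :=
  [/\ bil e e = 0, bil f f = 0, bil e f != 0, bil e w = 0 & bil f w = 0]
  /\ w != 0.

Definition comb e f w (t : F * F * F) : 'rV[F]_3 :=
  t.1.1 *: e + t.1.2 *: f + t.2 *: w.

Lemma frame_exists e f : e \in cone A -> f \in cone A -> bil e f != 0 ->
  exists w, frame e f w.
Proof.
move=> he hf ef; have [w w0 [hew hfw]] := orthogonal_exists e f.
by exists w; split=> //; split=> //; exact: cone_bil.
Qed.

Section Frame.
Variables (e f w : 'rV[F]_3).
Hypothesis efw : frame e f w.

(** Pairing with [e] isolates the coefficient of [f], and pairing with [f] that of [e]; then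
    [w != 0] settles the last one. *)
Lemma comb_inj : injective (comb e f w).
Proof.
have [[ee ff ef ew fw] w0] := efw.
have z0 x y z : x *: e + y *: f + z *: w = 0 -> [/\ x = 0, y = 0 & z = 0].
  move=> h.
  have /eqP : bil e (x *: e + y *: f + z *: w) = 0 by rewrite h bil0r.
  rewrite !bilE ee ew !mulr0 add0r addr0 mulf_eq0 (negPf ef) orbF => /eqP y0.
  have /eqP : bil f (x *: e + y *: f + z *: w) = 0 by rewrite h bil0r.
  rewrite !bilE ff fw !mulr0 !addr0 mulf_eq0 bilC (negPf ef) orbF => /eqP x0.
  move: h; rewrite x0 y0 !scale0r !add0r => /eqP; rewrite scaler_eq0 (negPf w0) orbF.
  by move=> /eqP ->.
move=> [[x y] z] [[x' y'] z']; rewrite /comb /= => h.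
have [|/eqP hx /eqP hy /eqP hz] := z0 (x - x') (y - y') (z - z').
  rewrite !scalerBl [_ - _ + _]addrACA -opprD [_ - _ + _]addrACA -opprD.
  by rewrite h subrr.
by move: hx hy hz; rewrite !subr_eq0 => /eqP -> /eqP -> /eqP ->.
Qed.

Lemma comb_bij : bijective (comb e f w).
Proof. by apply: inj_card_bij comb_inj _; rewrite card_mx !card_prod mul1n expnS expnS expn1 mulnA. Qed.

Lemma comb_ex v : exists x y z, v = x *: e + y *: f + z *: w.
Proof.
have [g _ gK] := comb_bij; exists (g v).1.1, (g v).1.2, (g v).2.
by rewrite -[in LHS](gK v).
Qed.

(** An isotropic [w] would be orthogonal to the whole frame, hence to the whole space, against
    non-degeneracy. *)
Lemma frame_aniso : bil w w != 0.
Proof.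
have [[ee ff ef ew fw] w0] := efw.
apply: contraNneq w0 => ww; apply/eqP/bil_nondeg => v.
have [x [y [z ->]]] := comb_ex v.
by rewrite !bilE !(bilC w) ?ew ?fw ww !mulr0 !addr0.
Qed.

Lemma bil_comb x y z x' y' z' :
  bil (x *: e + y *: f + z *: w) (x' *: e + y' *: f + z' *: w)
  = (x * y' + y * x') * bil e f + z * z' * bil w w.
Proof.
have [[ee ff ef ew fw] w0] := efw.
by rewrite !bilE (bilC f e) !(bilC w) ee ff ew fw; ring.
Qed.

Lemma comb_eq0 x y z :
  (x *: e + y *: f + z *: w == 0) = [&& x == 0, y == 0 & z == 0].
Proof.
have -> : (0 : 'rV[F]_3) = comb e f w (0, 0, 0) by rewrite /comb /= !scale0r !addr0.
by rewrite (inj_eq comb_inj (x, y, z)) !xpair_eqE andbA.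
Qed.

Lemma sum_comb (R : nmodType) (h : 'rV[F]_3 -> R) :
  \sum_v h v = \sum_x \sum_y \sum_z h (x *: e + y *: f + z *: w).
Proof.
rewrite (reindex (comb e f w)) /=; last exact/onW_bij/comb_bij.
by rewrite pair_bigA /= pair_bigA.
Qed.

(* The Gram determinant of the frame is [- bil w w * bil e f ^+ 2], a square times
   [\det A]; hence the class of [- bil w w] does not depend on the frame. *)
Lemma frame_det (R : realFieldType) : qchar R (- bil w w) = qchar R (\det A).
Proof.
have [[ee ff ef ew fw] w0] := efw.
pose P : 'M[F]_3 := \matrix_(i, j) (tnth [tuple e; f; w] i) 0 j.
have rowP i : row i P = tnth [tuple e; f; w] i by apply/rowP=> j; rewrite !mxE.
have PE i j : (P *m A *m P^T) i j = bil (tnth [tuple e; f; w] i) (tnth [tuple e; f; w] j).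
  rewrite /bil -!rowP -row_mul [LHS]mxE [RHS]mxE; apply: eq_bigr => k _.
  by rewrite [row i _ 0 k]mxE [P^T k j]mxE [(row j P)^T k 0]mxE [row j P 0 k]mxE.
have detP : \det (P *m A *m P^T) = - bil w w * bil e f ^+ 2.
  move: PE; move: (P *m A *m P^T) => G PE.
  rewrite (expand_det_row _ 0) !big_ord_recl big_ord0 /cofactor.
  rewrite !(expand_det_row _ 0) !big_ord_recl !big_ord0 /cofactor !det_mx11 !mxE.
  rewrite !PE /= !(tnth_nth 0) /= ?(bilC w) ?(bilC f e) ee ff ew fw.
  rewrite /bump /=; ring.
have detP0 : \det P != 0.
  apply/eqP=> P0; have /eqP := detP; rewrite !det_mulmx P0 !mul0r eq_sym.
  by rewrite mulf_eq0 oppr_eq0 (negPf frame_aniso) expf_eq0 (negPf ef) andbF.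
rewrite -(qcharMsq _ _ ef) mulrC -detP !det_mulmx det_tr.
by rewrite -(qcharMsq _ (\det A) detP0) expr2 mulrC mulrA.
Qed.
End Frame.

Lemma partner_exists e : e \in cone A -> exists2 f, f \in cone A & bil e f != 0.
Proof.
move=> he; have ee := cone_bil he.
have [v hv] : exists v, bil e v != 0.
  apply/existsP; apply: contraTT (cone_neq0 he) => /existsPn h.
  by rewrite negbK; apply/eqP/bil_nondeg => v; apply/eqP; rewrite -[_ == _]negbK.
(* The root of [bil v v + 2 * c * bil e v = 0]: moving [v] along the isotropic [e] brings it into
   the cone. *)
pose c := - bil v v / (2 * bil e v).
have hef : bil e (v + c *: e) = bil e v by rewrite !bilE ee mulr0 addr0.
exists (v + c *: e); last by rewrite hef.
rewrite in_cone; apply/andP; split.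
  by apply: contraNneq hv => h; rewrite -hef h bil0r.
by rewrite !bilE ee (bilC v e) /c; apply/eqP; field; rewrite hv (two_neq0 charF).
Qed.

(** In a frame starting with [u], orthogonality to [u] removes the coefficient of [f]; then
    [bil v v] is [z ^+ 2 * bil w w], which removes that of [w]. *)
Lemma collinear u v : u \in cone A -> v \in cone A -> bil u v = 0 ->
  exists2 t, t != 0 & v = t *: u.
Proof.
move=> hu hv uv; have [f hf uf] := partner_exists hu.
have [w fr] := frame_exists hu hf uf; have := fr => -[[uu ff _ uw fw] w0].
have [x [y [z E]]] := comb_ex fr v.
have /eqP : bil u v = 0 by [].
rewrite E !bilE uu uw !mulr0 add0r addr0 mulf_eq0 (negPf uf) orbF => /eqP y0.
have /eqP := cone_bil hv; rewrite E (bil_comb fr) y0 mulr0 !mul0r addr0 mul0r add0r.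
rewrite !mulf_eq0 orbb (negPf (frame_aniso fr)) orbF => /eqP z0.
move: E; rewrite y0 z0 !scale0r !addr0 => E; exists x => //.
by apply: contraTneq (cone_neq0 hv) => x0; rewrite E x0 scale0r eqxx.
Qed.

Lemma bil_eq0_sub u v : u \in cone A -> v \in cone A ->
  (v - u \in cone A) = (u != v) && (bil u v == 0).
Proof.
move=> hu hv; rewrite in_cone subr_eq0 eq_sym; congr andb.
rewrite !bilE (cone_bil hu) (cone_bil hv) (bilC v u).
rewrite (_ : _ + _ = - (2 * bil u v)) ?oppr_eq0 ?mulf_eq0 ?(negPf (two_neq0 charF)) //; ring.
Qed.
End Cone.

(** * Counting points *)

Section Conics.
Variables (R : realFieldType) (F : finFieldType).
Hypothesis charF : 2%N \notin [pchar F].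
Local Notation qchar := (qchar R).

Lemma qchar_root (x : F) : 1 + qchar x != 0 -> exists z, z ^+ 2 = x.
Proof.
have [->|x0] := eqVneq x 0; first by exists 0; rewrite expr0n.
by case: (qcharP R charF x0) => [[_ [s _ ->]]|->]; [exists s | rewrite subrr eqxx].
Qed.

Lemma card_gt2 : (2 < #|F|)%N.
Proof.
have h : uniq [:: 0; 1; -1 : F].
  rewrite /= !inE !negb_or eq_sym oner_neq0 eq_sym oppr_eq0 oner_neq0 /= andbT.
  by rewrite -subr_eq0 opprK -mulr2n (two_neq0 charF).
by have := max_card (mem [:: 0; 1; -1 : F]); rewrite (card_uniqP h).
Qed.

End Conics.

(** [h s] counts the solutions with [a * x ^+ 2 = s]. Its sum over [s] is [#|F|] minus a sign, hence
    positive, so some [h s] is nonzero. *)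
Lemma binary_form_represents (F : finFieldType) (charF : 2%N \notin [pchar F])
  (a b c : F) : a != 0 -> b != 0 -> c != 0 ->
  exists x y, a * x ^+ 2 + b * y ^+ 2 = c.
Proof.
move=> a0 b0 c0.
pose h s := (1 + qchar rat (s / a)) * (1 + qchar rat ((c - s) / b)).
have [s hs|h0] := pickP (fun s => h s != 0).
  move: hs; rewrite mulf_eq0 negb_or => /andP[].
  move=> /(qchar_root charF)[x hx] /(qchar_root charF)[y hy].
  by exists x, y; rewrite hx hy; field; rewrite a0 b0.
have sum0 : \sum_s h s = 0 by rewrite big1 // => s _; apply/eqP/negbFE/h0.
have sumh : \sum_s h s = #|F|%:R - qchar rat (a^-1 * b^-1 * -1).
  rewrite (eq_bigr (fun s => 1 + qchar rat s * qchar rat a^-1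
    + qchar rat (c - s) * qchar rat b^-1
    + qchar rat s * qchar rat (c - s) * (qchar rat a^-1 * qchar rat b^-1))).
    rewrite !big_split /= -!mulr_suml sum_qchar (sum_reflect (@qchar rat F)) sum_qchar.
    rewrite sum_qchar_mul_sub // sumr_const !qcharM //.
    by rewrite !mul0r !addr0; congr (_ + _); ring.
  by move=> s _; rewrite /h !qcharM //; ring.
have : (1 : rat) < #|F|%:R.
  by rewrite ltr1n (ltn_trans _ (card_gt2 charF)).
move: sum0; rewrite sumh => /eqP; rewrite subr_eq0 => /eqP ->.
have /(qcharP rat charF) [[-> _]|->] : a^-1 * b^-1 * -1 != 0.
  by rewrite !mulf_neq0 ?invr_eq0 // oppr_eq0 oner_neq0.
- by rewrite ltxx.
- by move=> ?; exfalso; lra.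
Qed.

Section Counting.
Variables (R : realFieldType) (F : finFieldType) (A : 'M[F]_3).
Hypotheses (charF : 2%N \notin [pchar F]) (symA : A^T = A) (ndA : A \in unitmx).
Implicit Types (u v w e f : 'rV[F]_3) (a b c x y z : F).
Local Notation qchar := (qchar R).
Local Notation bil := (bil A).

(** For an anisotropic form, take [e], [f], [g] nonzero and pairwise orthogonal: the binary form on
    [e] and [f] represents [- bil g g], which produces an isotropic vector. *)
Lemma cone_nonempty : exists e, e \in cone A.
Proof.
apply/existsP/contraT => /existsPn h.
have aniso v : v != 0 -> bil v v != 0.
  by move=> v0; have := h v; rewrite in_cone v0.
have e0 : delta_mx 0 0 != 0 :> 'rV[F]_3.
  by apply/eqP=> /matrixP/(_ 0 0)/eqP; rewrite !mxE !eqxx oner_eq0.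
set e := delta_mx 0 0 in e0.
have [f f0 [ef _]] := orthogonal_exists symA e e.
have [g g0 [eg fg]] := orthogonal_exists symA e f.
have c0 : - bil g g != 0 by rewrite oppr_eq0 aniso.
have [x [y hxy]] := binary_form_represents charF (aniso _ e0) (aniso _ f0) c0.
have : bil (x *: e + y *: f + g) (x *: e + y *: f + g) = 0.
  rewrite !(bilE symA) (bilC symA f e) (bilC symA g e) (bilC symA g f) ef eg fg.
  transitivity (bil e e * x ^+ 2 + bil f f * y ^+ 2 + bil g g); first by ring.
  by rewrite hxy addNr.
have n0 : x *: e + y *: f + g != 0.
  apply: contraNneq (aniso _ g0) => h0.
  have : bil g (x *: e + y *: f + g) = 0 by rewrite h0 bil0r.
  by rewrite !(bilE symA) !(bilC symA g) eg fg !mulr0 !add0r => ->.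
by move=> /eqP; rewrite (negPf (aniso _ n0)).
Qed.

Lemma sum_line u (h : 'rV[F]_3 -> R) : u \in cone A ->
  \sum_(v in cone A | bil u v == 0) h v = \sum_(t | t != 0) h (t *: u).
Proof.
(* [g] recovers the factor of a multiple of [u]; the default [0] is never reached on the range of
   summation. *)
move=> hu; pose g (v : 'rV[F]_3) : F := odflt 0 [pick t | v == t *: u].
have gK t : g (t *: u) = t.
  rewrite /g; case: pickP => [t'|/(_ t)]; last by rewrite eqxx.
  rewrite -subr_eq0 -scalerBl scaler_eq0 (negPf (cone_neq0 hu)) orbF subr_eq0.
  by move=> /eqP.
rewrite (reindex_onto (fun t => t *: u) g) /=.
  apply: eq_bigl => t; rewrite gK eqxx andbT.
  have [->|t0] := eqVneq t 0; first by rewrite scale0r in_cone eqxx.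
  by rewrite coneZ // hu bilZr // (cone_bil hu) mulr0 eqxx.
move=> v /andP[hv /eqP uv]; have [t _ ->] := collinear charF symA ndA hu hv uv.
by rewrite gK.
Qed.

Lemma sum_nonzero1 : \sum_(t : F | t != 0) 1 = #|F|%:R - 1 :> R.
Proof.
have : \sum_(t : F) 1 = #|F|%:R :> R by rewrite sumr_const.
by rewrite (bigD1 0) //= => <-; rewrite [RHS]addrC addKr.
Qed.

Lemma card_line u : u \in cone A ->
  \sum_(v in cone A | bil u v == 0) 1 = #|F|%:R - 1 :> R.
Proof. by move=> hu; rewrite sum_line // sum_nonzero1. Qed.

(* In a frame [(u, v, w)], the completions are the [(1 - y) *: u + y *: v + z *: w]
   with [2 * y * (1 - y) * bil u v + z ^+ 2 * bil w w = 0]. *)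
Lemma sum_completion u v (h : F -> R) : u \in cone A -> v \in cone A ->
  bil u v != 0 ->
  \sum_(v' in cone A | u + v - v' \in cone A) h (bil u v')
  = \sum_b h b * (1 + qchar (2 * \det A * bil u v * b * (bil u v - b))).
Proof.
move=> hu hv; set a := bil u v => a0.
have [w fr] := frame_exists symA hu hv a0.
have [[uu vv _ uw vw] w0] := fr.
have d0 := frame_aniso symA ndA fr; set d := bil w w in d0.
rewrite big_mkcond (sum_comb symA fr) exchange_big /=.
have cond x y z : (x *: u + y *: v + z *: w \in cone A)
    && (u + v - (x *: u + y *: v + z *: w) \in cone A)
    = (x == 1 - y) && (z ^+ 2 == - (2 * y * (1 - y) * a / d)).
  have -> : u + v - (x *: u + y *: v + z *: w) = (1 - x) *: u + (1 - y) *: v + (- z) *: w.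
    by rewrite !scalerBl !scale1r scaleNr; apply/rowP => i; rewrite !mxE; ring.
  rewrite !in_cone !(comb_eq0 symA fr) !(bil_comb symA fr) -/a -/d.
  have -> : (x == 1 - y) && (z ^+ 2 == - (2 * y * (1 - y) * a / d))
     = (x == 1 - y) && (2 * y * (1 - y) * a + z ^+ 2 * d == 0).
    congr (_ && _); apply/eqP/eqP => h1; first by rewrite h1; field.
    by apply: (mulIf d0); rewrite mulNr mulfVK //; apply/eqP; rewrite -addr_eq0 addrC h1.
  have [->|xy] := eqVneq x (1 - y).
    have -> : 1 - (1 - y) = y by ring.
    have -> : ((1 - y) * y + y * (1 - y)) * a + z * z * d = 2 * y * (1 - y) * a + z ^+ 2 * d by ring.
    have -> : (y * (1 - y) + (1 - y) * y) * a + - z * - z * d = 2 * y * (1 - y) * a + z ^+ 2 * d by ring.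
    (* The coefficients [1 - y] and [y] cannot both vanish, so neither vector is zero and only the
       equation matters. *)
    case: (2 * y * (1 - y) * a + z ^+ 2 * d == 0); rewrite ?andbF //= !andbT subr_eq0.
    by have [<-|//] := eqVneq 1 y; rewrite ?oner_eq0 ?andbF.
  apply/negbTE; apply: contraNN xy => /andP[/andP[_ /eqP h1] /andP[_ /eqP h2]].
  (* The difference of the two cone equations. *)
  have : 2 * a * (1 - x - y) = 0.
    have := congr2 (fun s t => t - s) h1 h2; rewrite /= subrr => <-; ring.
  move=> /eqP; rewrite !mulf_eq0 (negPf (two_neq0 charF)) (negPf a0) /= subr_eq0.
  by move=> /eqP <-; rewrite subKr.
(* The completion with coefficient [y] on [v] has inner product [b = y * a] with [u]. *)
rewrite [RHS](reindex_onto (fun y => y * a) (fun b => b / a)) /=; last by move=> b _; rewrite mulfVK.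
rewrite [RHS](eq_bigl predT) => [|y]; last by rewrite mulfK ?eqxx.
apply: eq_bigr => y _; rewrite (bigD1 (1 - y)) //= [X in _ + X]big1 ?addr0 => [|x xy]; last first.
  by rewrite big1 // => z _; rewrite cond (negPf xy).
under eq_bigr => z _ do rewrite cond eqxx /=.
rewrite (eq_bigr (fun z => h (y * a) * (z ^+ 2 == - (2 * y * (1 - y) * a / d))%:R)); last first.
  move=> z _; rewrite !(bilE symA) uu uw -/a mulr0 mulr0 add0r addr0.
  by case: eqP; rewrite ?mulr1 ?mulr0.
rewrite -mulr_sumr; congr (_ * _).
have -> : forall x, \sum_z (z ^+ 2 == x)%:R = 1 + qchar x by move=> x; rewrite qcharE addrC subrK.
congr (1 + _).
have -> : 2 * \det A * a * (y * a) * (a - y * a) = a ^+ 2 * (2 * a * y * (1 - y) * \det A) by ring.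
(* Multiplication by [d ^+ 2] clears the denominator and leaves a factor [- d], whose class is that
   of [\det A]. *)
rewrite qcharMsq // -(qcharMsq _ (- _) d0).
have -> : d ^+ 2 * - (2 * y * (1 - y) * a / d) = 2 * a * y * (1 - y) * - d by field.
by rewrite [LHS]qcharM // [RHS]qcharM // (frame_det symA ndA fr).
Qed.

(** In a frame, given [x] and [y] there are [1 + qchar (k * x * y)] choices of [z]. The characters
    cancel in the sum over [y], which leaves [#|F| ^+ 2] zeros, the origin among them. *)
Lemma card_cone : #|cone A|%:R = #|F|%:R ^+ 2 - 1 :> R.
Proof.
have [e he] := cone_nonempty; have [f hf ef] := partner_exists charF symA ndA he.
have [w fr] := frame_exists symA he hf ef; have d0 := frame_aniso symA ndA fr.
have count0 : \sum_v (bil v v == 0)%:R = #|F|%:R ^+ 2 :> R.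
  pose k := - (2 * bil e f) / bil w w.
  rewrite (sum_comb symA fr).
  transitivity (\sum_(x : F) \sum_(y : F) (1 + qchar x * qchar k * qchar y)); last first.
    rewrite (eq_bigr (fun=> #|F|%:R)) => [|x _].
      by rewrite sumr_const expr2 mulr_natr.
    by rewrite big_split /= -mulr_sumr sum_qchar mulr0 addr0 sumr_const.
  apply: eq_bigr => x _; apply: eq_bigr => y _; rewrite -!qcharM // qcharE addrCA subrr addr0.
  apply: eq_bigr => z _; congr (_%:R); rewrite (bil_comb symA fr) /k.
  congr nat_of_bool; apply/eqP/eqP => h.
    by apply: (mulIf d0); apply/eqP; rewrite -subr_eq0 -h; apply/eqP; field.
  by rewrite -expr2 h; field.
have : \sum_v (bil v v == 0)%:R = 1 + \sum_(v in cone A) 1 :> R.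
  rewrite (bigD1 0) //= bil0r // eqxx; congr (_ + _).
  rewrite big_mkcond [RHS]big_mkcond /=; apply: eq_bigr => v _.
  by rewrite in_cone; case: (v != 0) => //=; case: (_ == 0).
by rewrite count0 sumr_const addrC => ->; rewrite addrK.
Qed.

End Counting.

(** * Cauchy-Schwarz and weights *)

Section FiniteSums.
Variable R : realFieldType.

(** Lagrange's identity behind Cauchy-Schwarz against the constant [1]; it yields both the
    inequality and its equality case. *)
Lemma sum_sqr_differences (I : finType) (P : pred I) (a : I -> R) :
  \sum_(i | P i) \sum_(j | P j) (a i - a j) ^+ 2
  = 2 * ((\sum_(i | P i) 1) * (\sum_(i | P i) a i ^+ 2) - (\sum_(i | P i) a i) ^+ 2).
Proof.
set n := \sum_(i | P i) 1; set S := \sum_(i | P i) _ ^+ 2; set s := \sum_(i | P i) a i.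
rewrite (eq_bigr (fun i => a i ^+ 2 * n + S * 1 - 2 * s * a i)).
  by rewrite sumrB big_split /= -mulr_suml -!mulr_sumr -/S -/s -/n; ring.
move=> i _; rewrite (eq_bigr (fun j => a i ^+ 2 * 1 + a j ^+ 2 - 2 * a i * a j)).
  by rewrite sumrB big_split /= -!mulr_sumr -/S -/s -/n; ring.
by move=> j _; ring.
Qed.

Lemma sqr_sum_le (I : finType) (P : pred I) (a : I -> R) :
  (\sum_(i | P i) a i) ^+ 2 <= (\sum_(i | P i) 1) * (\sum_(i | P i) a i ^+ 2).
Proof.
rewrite -subr_ge0 -(pmulr_rge0 _ (ltr0Sn R 1)) -sum_sqr_differences.
by apply: sumr_ge0 => i _; apply: sumr_ge0 => j _; apply: sqr_ge0.
Qed.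

Lemma sqr_sum_eq (I : finType) (P : pred I) (a : I -> R) :
  (\sum_(i | P i) a i) ^+ 2 = (\sum_(i | P i) 1) * (\sum_(i | P i) a i ^+ 2) ->
  forall i j, P i -> P j -> a i = a j.
Proof.
move=> h i j Pi Pj; have := sum_sqr_differences P a; rewrite h subrr mulr0 => h0.
have := psumr_eq0P (fun i _ => sumr_ge0 _ (fun j _ => sqr_ge0 (a i - a j))) h0.
move=> /(_ i Pi) h1.
have := psumr_eq0P (fun j _ => sqr_ge0 (a i - a j)) h1.
by move=> /(_ j Pj) /eqP; rewrite sqrf_eq0 subr_eq0 => /eqP.
Qed.

Lemma sum_translate (V : finZmodType) (P : pred V) (h : V -> R) (u : V) :
  \sum_(v | P v) h v = \sum_(v | P (u + v)) h (u + v).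
Proof.
rewrite (reindex_onto (fun v => u + v) (fun v => v - u)) /=.
  by apply: eq_bigl => v; rewrite [u + v - u]addrC addKr eqxx andbT.
by move=> v _; rewrite addrCA subrr addr0.
Qed.

Lemma sum_opp (V : finZmodType) (P : pred V) (h : V -> R) :
  \sum_(v | P v) h v = \sum_(v | P (- v)) h (- v).
Proof.
rewrite (reindex_onto (fun v => - v) (fun v => - v)) /=.
  by apply: eq_bigl => v; rewrite opprK eqxx andbT.
by move=> v _; rewrite opprK.
Qed.

End FiniteSums.

(** * Weights for the pairings and their character sums *)

Section Weights.
Variables (R : realFieldType) (F : finFieldType).
Hypothesis charF : 2%N \notin [pchar F].
Implicit Types a b c : F.
Local Notation qchar := (qchar R).
Local Notation q := (#|F|%:R : R).
Local Notation e := (qchar (-1 : F)).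

Lemma card_ge3 : 3 <= q.
Proof. by rewrite ler_nat card_gt2. Qed.

Lemma qcharN1_sq : e * e = 1.
Proof. by rewrite -expr2 qchar_sqr // oppr_eq0 oner_neq0. Qed.

(** For [k != 0] the product of the values at [a], [b] and [a - b] is [qchar (k * a * b * (a - b))],
    the character that counts completions when [k = 2 * \det A] and [a = bil u v]. *)
Definition twisted_qchar (k : F) a : R := qchar (k * a).

Definition pair_weight k (u v : R) a b : R :=
  if (b == 0) || (b == a) then 0
  else u + v * (2 * e * twisted_qchar k a - twisted_qchar k b - twisted_qchar k (a - b)).

(** The unrestricted summand [g] is a combination of known character sums; its terms at [b = 0] and
    [b = a] are then removed. The result sees [a] only through one character, which the choice of
    weights can cancel. *)
Lemma sum_pair_weight k (u v : R) a : k != 0 -> a != 0 ->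
  \sum_b pair_weight k u v a b * (1 + qchar (k * a * b * (a - b)))
  = u * (q - 2) + twisted_qchar k a * (2 * v - u * e + 2 * v * e * (q - 2)).
Proof.
move=> k0 a0.
pose g b := (u + v * (2 * e * twisted_qchar k a - twisted_qchar k b - twisted_qchar k (a - b)))
   * (1 + qchar (k * a * b * (a - b))).
have kk : qchar k * qchar k = 1 by rewrite -expr2 qchar_sqr // k0.
have aa : qchar a * qchar a = 1 by rewrite -expr2 qchar_sqr // a0.
have ee := qcharN1_sq.
have cst (c : R) : \sum_(b : F) c = c * q by rewrite sumr_const mulr_natr.
have gE b : g b = (u + 2 * v * e * qchar k * qchar a)
    - v * qchar k * qchar b - v * qchar k * qchar (a - b)
    + (u + 2 * v * e * qchar k * qchar a) * qchar k * qchar a * (qchar b * qchar (a - b))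
    - v * qchar a * (qchar b ^+ 2 * qchar (a - b))
    - v * qchar a * (qchar b * qchar (a - b) ^+ 2).
  rewrite /g /twisted_qchar !qcharM //.
  have -> : v * qchar a = v * qchar a * (qchar k * qchar k) by rewrite kk mulr1.
  ring.
have gsum : \sum_b g b = (u + 2 * v * e * qchar k * qchar a) * q
   - (u + 2 * v * e * qchar k * qchar a) * qchar k * qchar a * e + 2 * v.
  rewrite (eq_bigr _ (fun b _ => gE b)) !sumrB !big_split /= !sumrN -!mulr_sumr.
  rewrite sum_qchar (sum_reflect (fun b : F => qchar b)) sum_qchar sum_qchar_mul_sub //.
  rewrite sum_qchar_sqr_sub // sum_qchar_sub_sqr // !cst.
  ring: aa kk.
have -> : \sum_b pair_weight k u v a b * (1 + qchar (k * a * b * (a - b))) = \sum_b g b - g 0 - g a.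
  rewrite [\sum_b g b](bigD1 0) //= [X in g 0 + X](bigD1 a) //= (bigD1 0) //= [X in _ + X = _](bigD1 a) //=.
  rewrite /pair_weight !eqxx orbT !mul0r !add0r [RHS](_ : _ = \sum_(b | (b != 0) && (b != a)) g b).
    by apply: eq_bigr => b /andP[/negPf -> /negPf ->].
  by ring.
rewrite gsum !gE !subrr !subr0 qchar0 /twisted_qchar qcharM //.
ring: aa kk ee.
Qed.
End Weights.

(** * Quadruples with non-orthogonal sum *)

Section GenericQuadruples.
Variables (R : realFieldType) (F : finFieldType) (A : 'M[F]_3).
Hypotheses (charF : 2%N \notin [pchar F]) (symA : A^T = A) (ndA : A \in unitmx).
Local Notation V := 'rV[F]_3.
Implicit Types (x : V) (a b c : F).
Local Notation qchar := (qchar R).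
Local Notation bil := (bil A).
Local Notation q := (#|F|%:R : R).
Local Notation e := (qchar (-1 : F)).
Local Notation C := (cone A).

(* The last equation says that the quadratic characters cancel in the total weight
   of a non-orthogonal pair, collected over the three pairings. *)
Definition weights (u u' v : R) :=
  [/\ u + 2 * u' = 1, 4 * `|v| <= u, 4 * `|v| <= u'
    & 2 * v - u * e + 2 * v * e * (q - 2)
      + 2 * e * (2 * v - u' * e + 2 * v * e * (q - 2)) = 0].

(** If [-1] is a square, taking [u = u'] reduces the last equation to [2 * v * (q - 1) = u], and
    [4 * v <= u] amounts to [3 <= q]. Otherwise [v = 0] leaves [u = 2 * u']. *)
Lemma weights_exist : exists u u' v, weights u u' v.
Proof.
have q3 := card_ge3 R charF.
have /(qcharP R charF) [[e1 _]|e1] : -1 != 0 :> F by rewrite oppr_eq0 oner_neq0.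
- exists 3^-1, 3^-1, (6 * (q - 1))^-1; rewrite /weights e1.
  have q1 : q - 1 != 0 by apply/eqP; lra.
  have v0 : 0 <= (6 * (q - 1))^-1 by rewrite invr_ge0; lra.
  have v1 : 4 * `|(6 * (q - 1))^-1| <= 3^-1.
    rewrite ger0_norm // -ler_pdivlMl ?ltr0n // -[leRHS]invrK lef_pV2 ?posrE; lra.
  by split=> //; [lra | field].
- exists 2^-1, 4^-1, 0; rewrite /weights e1 normr0 mulr0.
  by split; lra.
Qed.

Definition quad (t : (V * V) * (V * V)) : bool :=
  [&& t.1.1 \in C, t.1.2 \in C, t.2.1 \in C, t.2.2 \in C,
      t.1.1 + t.1.2 == t.2.1 + t.2.2 & bil t.1.1 t.1.2 != 0].

Definition qsum (G : V -> V -> V -> V -> R) : R :=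
  \sum_(t | quad t) G t.1.1 t.1.2 t.2.1 t.2.2.

(** That [x1 + x2 - x3] is isotropic means [bil x1 x2 = bil x1 x3 + bil x2 x3]. Hence [bil x1 x2]
    and [bil x1 x3] determine all six inner products. *)
Lemma quad_bil x1 x2 x3 x4 : quad ((x1, x2), (x3, x4)) ->
  [/\ bil x3 x4 = bil x1 x2, bil x2 x4 = bil x1 x3,
      bil x2 x3 = bil x1 x4 & bil x1 x4 = bil x1 x2 - bil x1 x3].
Proof.
move=> /and5P[/= h1 h2 h3 h4 /andP[/eqP h _]].
have two0 := two_neq0 charF.
have h4E : x4 = x1 + x2 - x3 by rewrite h addrAC subrr add0r.
have c1 := cone_bil h1; have c2 := cone_bil h2; have c3 := cone_bil h3.
have := cone_bil h4; rewrite h4E !(bilE symA) c1 c2 c3.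
rewrite (bilC symA x2 x1) (bilC symA x3 x1) (bilC symA x3 x2) => c4.
have E : bil x1 x2 = bil x1 x3 + bil x2 x3.
  by apply: (mulfI two0); apply/eqP; rewrite -subr_eq0 -c4; apply/eqP; ring.
by split; rewrite ?E; ring.
Qed.

Lemma quad_swap x1 x2 x3 x4 :
  quad ((x1, x2), (x3, x4)) = quad ((x3, x4), (x1, x2)).
Proof.
suff imp y1 y2 y3 y4 : quad ((y1, y2), (y3, y4)) -> quad ((y3, y4), (y1, y2)).
  by apply/idP/idP; apply: imp.
move=> h; have [h34 _ _ _] := quad_bil h; case/and5P: h => /= h1 h2 h3 h4 /andP[/eqP h b].
by rewrite /quad /= h1 h2 h3 h4 h h34 eqxx.
Qed.

(** This symmetry and the next two carry every pair of indices to {12} or {13} without mixing the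
    pairing {12|34} with the other two. *)
Lemma qsum_3412 G : qsum G = qsum (fun x1 x2 x3 x4 => G x3 x4 x1 x2).
Proof.
have inj : injective (fun t : (V * V) * (V * V) => (t.2, t.1)).
  by move=> [? ?] [? ?] [-> ->].
rewrite /qsum (reindex_inj inj) /=; apply: eq_bigl => -[[x1 x2] [x3 x4]].
by rewrite quad_swap.
Qed.

Lemma qsum_2143 G : qsum G = qsum (fun x1 x2 x3 x4 => G x2 x1 x4 x3).
Proof.
have inj : injective (fun t : (V * V) * (V * V) => ((t.1.2, t.1.1), (t.2.2, t.2.1))).
  by move=> [[? ?] [? ?]] [[? ?] [? ?]] [-> -> -> ->].
rewrite /qsum (reindex_inj inj) /=; apply: eq_bigl => -[[x1 x2] [x3 x4]].
rewrite /quad /= (bilC symA x2) [x2 + x1]addrC [x4 + x3]addrC.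
by case: (x1 \in C); case: (x2 \in C); case: (x3 \in C); case: (x4 \in C).
Qed.

Lemma qsum_1243 G : qsum G = qsum (fun x1 x2 x3 x4 => G x1 x2 x4 x3).
Proof.
have inj : injective (fun t : (V * V) * (V * V) => (t.1, (t.2.2, t.2.1))).
  by move=> [[? ?] [? ?]] [[? ?] [? ?]] [-> -> -> ->].
rewrite /qsum (reindex_inj inj) /=; apply: eq_bigl => -[[x1 x2] [x3 x4]].
rewrite /quad /= [x4 + x3]addrC.
by case: (x1 \in C); case: (x2 \in C); case: (x3 \in C); case: (x4 \in C).
Qed.

Lemma qsumE12 G : qsum G
  = \sum_(x1 in C) \sum_(x2 in C | bil x1 x2 != 0)
      \sum_(x3 in C | x1 + x2 - x3 \in C) G x1 x2 x3 (x1 + x2 - x3).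
Proof.
rewrite /qsum (reindex_onto (fun s : V * V * V => (s.1, (s.2, s.1.1 + s.1.2 - s.2)))
  (fun t => (t.1, t.2.1))) /=; last first.
  move=> [[x1 x2] [x3 x4]] /and5P[/= _ _ _ _ /andP[/eqP -> _]].
  by rewrite [x3 + x4]addrC addrK.
rewrite pair_big_dep pair_big_dep /=; apply: eq_bigl => -[[x1 x2] x3].
rewrite /quad /= eqxx andbT [x3 + _]addrC subrK eqxx /=.
by case: (x1 \in C); case: (x2 \in C); case: (x3 \in C); rewrite ?andbF //= andbC.
Qed.

(** Here [x2] is eliminated, so [x4] runs over the completions of the pair [(x1, - x3)].
    Non-orthogonality of [x1] and [x2] still depends on [x4] and stays inside the sum. *)
Lemma qsumE13 G : qsum G
  = \sum_(x1 in C) \sum_(x3 in C) \sum_(x4 in C | x1 - x3 - x4 \in C)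
      if bil x1 (x3 + x4 - x1) != 0 then G x1 (x3 + x4 - x1) x3 x4 else 0.
Proof.
under [RHS]eq_bigr => x1 _ do under eq_bigr => x3 _ do rewrite -big_mkcondr.
rewrite /qsum (reindex_onto (fun s : V * V * V => ((s.1.1, s.1.2 + s.2 - s.1.1), (s.1.2, s.2)))
  (fun t => ((t.1.1, t.2.1), t.2.2))) /=; last first.
  move=> [[x1 x2] [x3 x4]] /and5P[/= _ _ _ _ /andP[/eqP <- _]].
  by rewrite [x1 + x2]addrC addrK.
rewrite pair_big_dep pair_big_dep /=; apply: eq_bigl => -[[x1 x3] x4].
rewrite /quad /= eqxx andbT [x1 + _]addrC subrK eqxx /=.
have -> : x1 - x3 - x4 = - (x3 + x4 - x1) by rewrite opprB opprD addrA.
rewrite coneN //.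
by case: (x1 \in C); case: (_ \in C); case: (x3 \in C); case: (x4 \in C); rewrite ?andbF.
Qed.

Section Weighted.
Variables (u u' v : R).
Hypothesis hw : weights u u' v.
Local Notation k := (2 * \det A).
Local Notation tau := (twisted_qchar R k).

(** When [x3] or [x4] is orthogonal to [x1], the whole weight goes to {12|34}, whose pairs are never
    orthogonal. *)
Definition weight12 a b : R :=
  ((b == 0) || (b == a))%:R + pair_weight k u v a b.

Definition weight13 a b : R :=
  if (b == 0) || (b == a) then 0
  else u' + v * (2 * tau b - e * tau a - tau (a - b)).

Lemma k_neq0 : k != 0.
Proof. by apply: mulf_neq0; [exact: two_neq0 | rewrite -unitfE -unitmxE]. Qed.

Lemma normr_qchar (z : F) : `|qchar z| <= 1.
Proof.
have [->|z0] := eqVneq z 0; first by rewrite qchar0 normr0.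
by case: (qcharP R charF z0) => [[-> _]|->]; rewrite ?normrN normr1.
Qed.

Lemma weight_ge0 (s : R) (z1 z2 z3 : R) : 4 * `|v| <= s ->
  `|z1| <= 1 -> `|z2| <= 1 -> `|z3| <= 1 -> 0 <= s + v * (2 * z1 - z2 - z3).
Proof.
move=> hs; rewrite !ler_norml => /andP[? ?] /andP[? ?] /andP[? ?].
have : `|v * (2 * z1 - z2 - z3)| <= `|v| * 4.
  by rewrite normrM ler_wpM2l // ler_norml; apply/andP; split; lra.
by rewrite ler_norml => /andP[? _]; lra.
Qed.

Lemma normr_etau a : `|e * tau a| <= 1.
Proof. by rewrite -qcharM // normr_qchar. Qed.

Lemma weight12_ge0 a b : 0 <= weight12 a b.
Proof.
have [_ h _ _] := hw; rewrite /weight12 /pair_weight.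
case: ifP => _; first by rewrite addr0.
by rewrite add0r -mulrA weight_ge0 ?normr_etau ?normr_qchar.
Qed.

Lemma weight13_ge0 a b : 0 <= weight13 a b.
Proof.
have [_ _ h _] := hw; rewrite /weight13; case: ifP => // _.
by rewrite weight_ge0 ?normr_etau ?normr_qchar.
Qed.

(** The map [b] to [a - b] exchanges [x3] and [x4]. The coefficients of [v] cancel over the three
    pairings, leaving [u + 2 * u' = 1]. *)
Lemma weight_sum a b : weight12 a b + weight13 a b + weight13 a (a - b) = 1.
Proof.
have [h _ _ _] := hw; rewrite /weight12 /pair_weight /weight13.
have -> : (a - b == 0) = (b == a) by rewrite subr_eq0 eq_sym.
have -> : (a - b == a) = (b == 0) by rewrite -subr_eq0 addrAC subrr sub0r oppr_eq0.
rewrite orbC subKr; case: ifP => _ /=; first by rewrite !addr0.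
by rewrite -[RHS]h; ring.
Qed.

Definition weighted_quad (f : V -> R) x1 x2 x3 x4 : R :=
  let a := bil x1 x2 in let b := bil x1 x3 in
  weight12 a b * ((f x1 ^+ 2 * f x2 ^+ 2 + f x3 ^+ 2 * f x4 ^+ 2) / 2)
  + weight13 a b * ((f x1 ^+ 2 * f x3 ^+ 2 + f x2 ^+ 2 * f x4 ^+ 2) / 2)
  + weight13 a (a - b) * ((f x1 ^+ 2 * f x4 ^+ 2 + f x2 ^+ 2 * f x3 ^+ 2) / 2).

Lemma prod_le_weighted_quad (f : V -> R) x1 x2 x3 x4 :
  f x1 * f x2 * f x3 * f x4 <= weighted_quad f x1 x2 x3 x4.
Proof.
rewrite /weighted_quad; set a := bil x1 x2; set b := bil x1 x3.
have amgm (s t : R) : s * t <= (s ^+ 2 + t ^+ 2) / 2.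
  by have := sqr_ge0 (s - t); rewrite sqrrB; lra.
rewrite -[leLHS]mul1r -[X in X * _ <= _](weight_sum a b) [leLHS]mulrDl [X in X + _ <= _]mulrDl -!exprMn.
apply: lerD; first apply: lerD; rewrite ler_wpM2l ?weight12_ge0 ?weight13_ge0 //.
- by rewrite (le_trans _ (amgm _ _)) // !mulrA.
- by rewrite (le_trans _ (amgm _ _)) // le_eqVlt; apply/orP; left; apply/eqP; ring.
- by rewrite (le_trans _ (amgm _ _)) // le_eqVlt; apply/orP; left; apply/eqP; ring.
Qed.

Lemma sum_weight12 a : a != 0 ->
  \sum_b weight12 a b * (1 + qchar (k * a * b * (a - b)))
  = 2 + u * (q - 2) + tau a * (2 * v - u * e + 2 * v * e * (q - 2)).
Proof.
move=> a0; rewrite /weight12.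
under eq_bigr => b _ do rewrite mulrDl.
rewrite big_split /= sum_pair_weight ?k_neq0 // addrA; congr (_ + _ + _).
(* The degenerate values [b = 0] and [b = a] each have one completion and give the summand [2]. *)
rewrite (bigD1 0) //= (bigD1 a) //= big1 => [|b /andP[/negPf -> /negPf ->]]; last exact: mul0r.
by rewrite !eqxx orbT subrr /= !mulr0 mul0r qchar0; ring.
Qed.

(* The pair [(x1, x3)] plays the role of [(x1, x2)] in the relation
   [x1 + (- x3) = x4 + (- x2)], whence the sign of [b]. *)
Lemma sum_weight13 b : b != 0 ->
  \sum_c (if b + c == 0 then 0 else weight13 (b + c) b)
     * (1 + qchar (k * - b * c * (- b - c)))
  = u' * (q - 2) + e * tau b * (2 * v - u' * e + 2 * v * e * (q - 2)).
Proof.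
move=> b0; have tauN z : tau (- z) = e * tau z.
  by rewrite /twisted_qchar -qcharM //; congr qchar; ring.
rewrite -tauN -sum_pair_weight ?k_neq0 ?oppr_eq0 //; apply: eq_bigr => c _.
congr (_ * _); rewrite /weight13 /pair_weight (negPf b0) /=.
have -> : (b == b + c) = (c == 0).
  by rewrite -subr_eq0 opprD addrA subrr sub0r oppr_eq0.
have -> : (b + c == 0) = (c == - b) by rewrite addrC addr_eq0.
case: (c == - b); rewrite ?orbT // orbF; case: ifP => // _.
have -> : b + c - b = c by rewrite addrAC subrr add0r.
rewrite -opprD !tauN; ring: (qcharN1_sq R charF).
Qed.

Lemma eq_qsum (G G' : V -> V -> V -> V -> R) :
  (forall x1 x2 x3 x4, quad ((x1, x2), (x3, x4)) -> G x1 x2 x3 x4 = G' x1 x2 x3 x4) ->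
  qsum G = qsum G'.
Proof. by move=> h; apply: eq_bigr => -[[x1 x2] [x3 x4]]; apply: h. Qed.

(** By symmetry the two terms of {12|34} have the same sum, and so have the four terms of the other
    pairings; each term carries a factor one half. *)
Lemma qsum_weighted_pairs (f : V -> R) :
  qsum (weighted_quad f)
  = qsum (fun x1 x2 x3 _ => weight12 (bil x1 x2) (bil x1 x3) * (f x1 ^+ 2 * f x2 ^+ 2))
  + 2 * qsum (fun x1 x2 x3 _ => weight13 (bil x1 x2) (bil x1 x3) * (f x1 ^+ 2 * f x3 ^+ 2)).
Proof.
pose W12 x1 x2 x3 := weight12 (bil x1 x2) (bil x1 x3).
pose W13 x1 x2 x3 := weight13 (bil x1 x2) (bil x1 x3).
pose W14 x1 x2 x3 := weight13 (bil x1 x2) (bil x1 x2 - bil x1 x3).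
set T12 := (X in X + 2 * _); set T13 := (X in _ + 2 * X).
have h34 : qsum (fun x1 x2 x3 x4 => W12 x1 x2 x3 * (f x3 ^+ 2 * f x4 ^+ 2)) = T12.
  rewrite qsum_3412; apply: eq_qsum => x1 x2 x3 x4 /quad_bil[h _ _ _].
  by rewrite /W12 h (bilC symA x3 x1).
have h24 : qsum (fun x1 x2 x3 x4 => W13 x1 x2 x3 * (f x2 ^+ 2 * f x4 ^+ 2)) = T13.
  rewrite qsum_2143; apply: eq_qsum => x1 x2 x3 x4 /quad_bil[_ h _ _].
  by rewrite /W13 h (bilC symA x2 x1).
have h14 : qsum (fun x1 x2 x3 x4 => W14 x1 x2 x3 * (f x1 ^+ 2 * f x4 ^+ 2)) = T13.
  rewrite qsum_1243; apply: eq_qsum => x1 x2 x3 x4 /quad_bil[_ _ _ h].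
  by rewrite /W14 h subKr.
have h23 : qsum (fun x1 x2 x3 x4 => W14 x1 x2 x3 * (f x2 ^+ 2 * f x3 ^+ 2)) = T13.
  rewrite -h14 qsum_2143; apply: eq_qsum => x1 x2 x3 x4 /quad_bil[_ h _ _].
  by rewrite /W14 h (bilC symA x2 x1).
have -> : qsum (weighted_quad f) = (T12 + T12 + T13 + T13 + T13 + T13) / 2.
  rewrite -{2}h34 -{2}h24 -{2}h14 -{2}h23.
  rewrite /qsum -!big_split mulr_suml; apply: eq_bigr => t _.
  by rewrite /weighted_quad /W12 /W13 /W14 /=; field.
by field.
Qed.

(** Each non-orthogonal pair collects [2 + (u + 2 * u') * (q - 2) = q], while its character part
    vanishes by the last equation of [weights]. *)
Lemma qsum_weighted (f : V -> R) : qsum (weighted_quad f)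
  = q * \sum_(x1 in C) \sum_(x2 in C | bil x1 x2 != 0) f x1 ^+ 2 * f x2 ^+ 2.
Proof.
rewrite qsum_weighted_pairs qsumE12 qsumE13.
have [hu _ _ hz] := hw.
rewrite (eq_bigr (fun x1 => \sum_(x2 in C | bil x1 x2 != 0) f x1 ^+ 2 * f x2 ^+ 2
   * (2 + u * (q - 2) + tau (bil x1 x2) * (2 * v - u * e + 2 * v * e * (q - 2))))); last first.
  move=> x1 h1; apply: eq_bigr => x2 /andP[h2 b0].
  rewrite -(sum_weight12 b0) -(sum_completion charF symA ndA (weight12 _) h1 h2 b0).
  by rewrite mulr_sumr; apply: eq_bigr => x3 _; rewrite mulrC.
rewrite [in X in _ + 2 * X](eq_bigr (fun x1 => \sum_(x2 in C | bil x1 x2 != 0) f x1 ^+ 2 * f x2 ^+ 2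
   * (u' * (q - 2) + e * tau (bil x1 x2) * (2 * v - u' * e + 2 * v * e * (q - 2))))); last first.
  move=> x1 h1; rewrite [RHS]big_mkcondr; apply: eq_bigr => x3 h3.
  case: ifPn => [b0|/negPn/eqP b0]; last first.
    by apply: big1 => x4 _; case: ifP => //; rewrite /weight13 b0 eqxx mul0r.
  (* With [c = bil x1 x4], the sum [bil x1 x3 + c] is [bil x1 x2]. *)
  pose h c := if bil x1 x3 + c == 0 then 0 else weight13 (bil x1 x3 + c) (bil x1 x3).
  have h3' : - x3 \in C by rewrite coneN.
  have b0' : bil x1 (- x3) != 0 by rewrite (bilNr symA) oppr_eq0.
  have := sum_completion charF symA ndA h h1 h3' b0'.
  rewrite (bilNr symA) sum_weight13 // => <-.
  rewrite mulr_sumr; apply: eq_bigr => x4 _; rewrite !(bilE symA) (cone_bil h1) subr0 /h.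
  by case: eqP => _ /=; rewrite ?mulr0 // mulrC.
rewrite [X in _ + X = _]mulr_sumr -big_split [RHS]mulr_sumr; apply: eq_bigr => x1 _ /=.
rewrite [X in _ + X = _]mulr_sumr -big_split [RHS]mulr_sumr; apply: eq_bigr => x2 _ /=.
set FF := f x1 ^+ 2 * f x2 ^+ 2.
transitivity (FF * (2 + (u + 2 * u') * (q - 2) + tau (bil x1 x2)
  * (2 * v - u * e + 2 * v * e * (q - 2)
      + 2 * e * (2 * v - u' * e + 2 * v * e * (q - 2))))).
  by ring.
by rewrite hu hz; ring.
Qed.
End Weighted.

Lemma qsum_prod_le (f : V -> R) : qsum (fun x1 x2 x3 x4 => f x1 * f x2 * f x3 * f x4)
  <= q * \sum_(x1 in C) \sum_(x2 in C | bil x1 x2 != 0) f x1 ^+ 2 * f x2 ^+ 2.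
Proof.
have [u [u' [v hw]]] := weights_exist.
rewrite -(qsum_weighted hw); apply: ler_sum => t _; exact: prod_le_weighted_quad.
Qed.

(** AM-GM is an equality when all values agree, and the weights add up to [1]. *)
Lemma qsum_prod_cst (r : R) : qsum (fun _ _ _ _ => r * r * r * r)
  = q * \sum_(x1 in C) \sum_(x2 in C | bil x1 x2 != 0) r ^+ 2 * r ^+ 2.
Proof.
have [u [u' [v hw]]] := weights_exist.
rewrite -(qsum_weighted hw (fun=> r)); apply: eq_bigr => t _.
rewrite -[LHS]mul1r -(weight_sum hw (bil t.1.1 t.1.2) (bil t.1.1 t.2.1)) /weighted_quad.
by field.
Qed.
End GenericQuadruples.

(** * The additive energy of the cone *)

Section Energy.
Variables (R : realFieldType) (F : finFieldType) (A : 'M[F]_3).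
Hypotheses (charF : 2%N \notin [pchar F]) (symA : A^T = A) (ndA : A \in unitmx).
Local Notation V := 'rV[F]_3.
Implicit Types (x y w : V) (f : V -> R).
Local Notation bil := (bil A).
Local Notation q := (#|F|%:R : R).
Local Notation C := (cone A).
Local Notation s := (q ^+ 2 - 1).

Definition conv f w : R := \sum_(x in C | w - x \in C) f x * f (w - x).
Definition energy f : R := \sum_w conv f w ^+ 2.

Definition mass f : R := \sum_(x in C) f x ^+ 2.
Definition antipodal f : R := \sum_(x in C) f x * f (- x).
Definition antipodal2 f : R := \sum_(x in C) f x ^+ 2 * f (- x) ^+ 2.
Definition radial f : R := \sum_(x in C) \sum_(y in C | bil x y == 0) f x ^+ 2 * f y ^+ 2.
Definition transverse f : R := \sum_(x in C) \sum_(y in C | bil x y != 0) f x ^+ 2 * f y ^+ 2.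

Lemma conv0 f : conv f 0 = antipodal f.
Proof.
rewrite /conv big_mkcondr /antipodal; apply: eq_bigr => x hx.
by rewrite sub0r coneN // hx.
Qed.

Lemma sum_cone1 : \sum_(x in C) 1 = s.
Proof. by rewrite sumr_const (card_cone R charF symA ndA). Qed.

Lemma mass_split f : mass f ^+ 2 = radial f + transverse f.
Proof.
rewrite expr2 [LHS]mulr_suml /radial /transverse -big_split /=; apply: eq_bigr => x _.
by rewrite mulr_sumr (bigID (fun y => bil x y == 0)).
Qed.

(** Opening one convolution with [w = x + y]: on the cone [bil w w = 2 * bil x y], so the condition
    on [w] is non-orthogonality of [x] and [y]. *)
Lemma sum_conv_transverse f : \sum_(w | bil w w != 0) conv f w ^+ 2
  = qsum A (fun x1 x2 x3 x4 => f x1 * f x2 * f x3 * f x4).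
Proof.
have two0 := two_neq0 charF.
rewrite qsumE12.
have -> : \sum_(w | bil w w != 0) conv f w ^+ 2
  = \sum_w \sum_(x in C | (w - x \in C) && (bil w w != 0)) f x * f (w - x) * conv f w.
  rewrite big_mkcond; apply: eq_bigr => w _; case: ifP => hb.
    rewrite expr2 {1}/conv mulr_suml; apply: eq_bigl => x; by rewrite andbT.
  by rewrite big1 // => x; rewrite !andbF.
rewrite (exchange_big_dep (fun x => x \in C)) /=; last by move=> w x _ /andP[].
apply: eq_bigr => x hx.
rewrite (sum_translate _ _ x).
apply: eq_big => [y|y].
  rewrite hx /= [x + y]addrC addrK; case hy: (y \in C) => //=.
  rewrite !(bilE symA) (cone_bil hx) (cone_bil hy) (bilC symA y x) addr0 add0r.
  by rewrite -mulr2n -mulr_natl mulf_eq0 (negPf two0).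
move=> _; rewrite [x + y - x]addrC addKr {1}/conv mulr_sumr.
by apply: eq_bigr => z _; rewrite !mulrA.
Qed.

Lemma cone_sub w x : w \in C ->
  (x \in C) && (w - x \in C) = [&& x \in C, bil w x == 0 & x != w].
Proof.
move=> hw; case hx: (x \in C) => //=.
by rewrite bil_eq0_sub // (bilC symA w) andbC.
Qed.

(** Here [x] runs over the [q - 1] nonzero points of the line of [w], except [w] itself. *)
Lemma card_cone_sub w : w \in C -> \sum_(x in C | w - x \in C) 1 = q - 2.
Proof.
move=> hw; have := card_line R charF symA ndA hw.
rewrite (bigD1 w) /=; last by rewrite hw (cone_bil hw) eqxx.
rewrite (eq_bigl (fun x => (x \in C) && (w - x \in C))) => [h|x].
  by apply: (addrI 1); rewrite h; ring.
by rewrite cone_sub // andbA.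
Qed.

(** With [w = x + y] these are the collinear pairs with [y != - x]; the excluded pairs make up
    [antipodal2 f]. *)
Lemma sum_conv_radial f :
  \sum_(w in C) \sum_(x in C | w - x \in C) f x ^+ 2 * f (w - x) ^+ 2
  = radial f - antipodal2 f.
Proof.
rewrite (exchange_big_dep (fun x => x \in C)) /=; last by move=> w x _ /andP[].
rewrite /radial /antipodal2 -sumrB; apply: eq_bigr => x hx.
rewrite [X in _ = X - _](bigD1 (- x)) /=; last first.
  by rewrite coneN // hx (bilNr symA) (cone_bil hx) oppr0 eqxx.
rewrite [RHS]addrAC subrr add0r (sum_translate _ _ x); apply: eq_big => [y|y _].
  rewrite [x + y - x]addrC addKr hx /=; case hy: (y \in C); rewrite ?andbF //= andbT.
  have hy' : - y \in C by rewrite coneN.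
  have := bil_eq0_sub charF symA hy' hx; rewrite opprK => ->.
  by rewrite bilNl oppr_eq0 (bilC symA y) eqr_oppLR andbC.
by rewrite [x + y - x]addrC addKr.
Qed.

Lemma energy_split f : energy f = antipodal f ^+ 2 + \sum_(w in C) conv f w ^+ 2
  + qsum A (fun x1 x2 x3 x4 => f x1 * f x2 * f x3 * f x4).
Proof.
rewrite -sum_conv_transverse /energy (bigD1 0) //= conv0 -addrA; congr (_ + _).
rewrite (bigID (fun w => bil w w == 0)) /=; congr (_ + _); apply: eq_bigl => w.
  by rewrite in_cone.
by have [->|//] := eqVneq w 0; rewrite (bil0r symA) eqxx.
Qed.

Lemma energy_le_parts f : energy f
  <= antipodal f ^+ 2 + (q - 2) * (radial f - antipodal2 f) + q * transverse f.
Proof.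
rewrite energy_split; apply: lerD; last exact: qsum_prod_le.
rewrite lerD2l -sum_conv_radial mulr_sumr; apply: ler_sum => w hw.
rewrite -(card_cone_sub hw) (le_trans (sqr_sum_le _ _)) // le_eqVlt; apply/orP; left.
by apply/eqP; congr (_ * _); apply: eq_bigr => x _; rewrite exprMn.
Qed.

(* Cauchy-Schwarz for the mass [K x] of the line through [x]: each line has [q - 1]
   nonzero points. *)
Lemma mass_radial f : mass f ^+ 2 <= (q + 1) * radial f.
Proof.
pose K x := \sum_(y in C | bil x y == 0) f y ^+ 2.
have q3 := card_ge3 R charF.
have card x : x \in C -> \sum_(y in C | bil y x == 0) 1 = q - 1 :> R.
  move=> hx; rewrite -(card_line R charF symA ndA hx).
  by apply: eq_bigl => y; rewrite bilC.
have sumK : \sum_(x in C) K x = (q - 1) * mass f.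
  rewrite (exchange_big_dep (fun x => x \in C)) /=; last by move=> ? ? _ /andP[].
  rewrite mulr_sumr; apply: eq_bigr => y hy; rewrite -(card y hy) mulr_suml.
  by apply: eq_big => [x|x _]; rewrite ?hy ?mul1r.
have sumK2 : \sum_(x in C) K x ^+ 2 = (q - 1) * radial f.
  rewrite (eq_bigr (fun x => \sum_(y in C | bil x y == 0) f y ^+ 2 * K x)); last first.
    by move=> x _; rewrite expr2 {1}/K mulr_suml.
  rewrite (exchange_big_dep (fun x => x \in C)) /=; last by move=> ? ? _ /andP[].
  rewrite mulr_sumr; apply: eq_bigr => y hy.
  rewrite (eq_bigr (fun x => 1 * (f y ^+ 2 * K y))) => [|x /andP[hx /andP[_ /eqP xy]]].
    rewrite -mulr_suml -mulr_sumr -(card y hy); congr (_ * _).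
    by apply: eq_bigl => x; rewrite hy.
  (* Points of one line are orthogonal to the same vectors, so [K x = K y]. *)
  rewrite mul1r; congr (_ * _); have [t t0 ->] := collinear charF symA ndA hx hy xy.
  by apply: eq_bigl => z; rewrite bilZl mulf_eq0 (negPf t0).
have := sqr_sum_le (fun x => x \in C) K; rewrite sumK sumK2 sum_cone1.
have -> : s * ((q - 1) * radial f) = (q - 1) ^+ 2 * ((q + 1) * radial f) by ring.
by rewrite exprMn ler_pM2l // exprn_gt0 //; lra.
Qed.

Lemma antipodal_sqr f : antipodal f ^+ 2 <= s * antipodal2 f.
Proof.
rewrite -sum_cone1 (le_trans (sqr_sum_le _ _)) // le_eqVlt; apply/orP; left.
by apply/eqP; congr (_ * _); apply: eq_bigr => x _; rewrite exprMn.
Qed.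

(** This gives [antipodal f <= mass f] and, in the case of equality, that [f] is even on the
    cone. *)
Lemma mass_antipodal f :
  \sum_(x in C) (f x - f (- x)) ^+ 2 = 2 * (mass f - antipodal f).
Proof.
have massN : mass f = \sum_(x in C) f (- x) ^+ 2.
  by rewrite /mass sum_opp; apply: eq_bigl => x; rewrite coneN.
rewrite (eq_bigr (fun x => f x ^+ 2 + f (- x) ^+ 2 - 2 * (f x * f (- x)))) => [|x _]; last by ring.
rewrite sumrB big_split /= -massN -mulr_sumr -/(antipodal f) -/(mass f); ring.
Qed.

(** The bracket of the sharp constant, multiplied by [s] to clear the denominator. *)
Local Notation lambda := (s * (q + 1) - (3 * q - 4)).

(** The slacks of the two bounds on [antipodal f ^+ 2] are kept on the left, with coefficients
    adding up to [s], so that the equality case can be read off. *)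
Lemma energy_deficit f :
  s * energy f + (s - (q - 2)) * (mass f ^+ 2 - antipodal f ^+ 2)
    + (q - 2) * (s * antipodal2 f - antipodal f ^+ 2) <= lambda * mass f ^+ 2.
Proof.
have q3 := card_ge3 R charF.
have s0 : 0 <= s by rewrite -sum_cone1 sumr_ge0.
have h1 := ler_wpM2l s0 (energy_le_parts f).
(* Exactly what remains of the right-hand side once [energy_le_parts] is scaled by [s]. *)
have h2 : 0 <= 2 * ((q - 1) * ((q + 1) * radial f - mass f ^+ 2)).
  by rewrite !mulr_ge0 ?subr_ge0 ?mass_radial //; lra.
rewrite (mass_split f) in h2 *.
rewrite -subr_ge0 (le_trans (addr_ge0 (etrans (subr_ge0 _ _) h1) h2)) //.
by rewrite le_eqVlt; apply/orP; left; apply/eqP; ring.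
Qed.

Lemma card_cone_gt : 0 < s - (q - 2).
Proof. have q3 := card_ge3 R charF; have : 0 <= q * (q - 3) by rewrite mulr_ge0 //; lra. rewrite mulrBr -expr2; lra. Qed.

Section Nonnegative.
Variable f : V -> R.
Hypothesis f0 : forall x, 0 <= f x.

Lemma antipodal_le_mass : antipodal f ^+ 2 <= mass f ^+ 2.
Proof.
rewrite ler_sqr ?nnegrE ?sumr_ge0 // => [|x _|x _]; rewrite ?mulr_ge0 ?sqr_ge0 //.
rewrite -subr_ge0 -(pmulr_rge0 _ (ltr0Sn R 1)) -mass_antipodal.
by apply: sumr_ge0 => x _; apply: sqr_ge0.
Qed.

Lemma energy_le : s * energy f <= lambda * mass f ^+ 2.
Proof.
have q3 := card_ge3 R charF; have s0 := card_cone_gt.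
apply: le_trans (energy_deficit f); rewrite -addrA lerDl addr_ge0 // mulr_ge0 //.
- exact: ltW.
- by rewrite subr_ge0 antipodal_le_mass.
- by lra.
- by rewrite subr_ge0 antipodal_sqr.
Qed.

Lemma energy_eq : s * energy f = lambda * mass f ^+ 2 ->
  forall x y, x \in C -> y \in C -> f x = f y.
Proof.
have q3 := card_ge3 R charF; have s0 := card_cone_gt.
move=> h; have := energy_deficit f; rewrite h -addrA gerDl => d.
have d1 : 0 <= (s - (q - 2)) * (mass f ^+ 2 - antipodal f ^+ 2).
  by rewrite mulr_ge0 ?(ltW s0) // subr_ge0 antipodal_le_mass.
have d2 : 0 <= (q - 2) * (s * antipodal2 f - antipodal f ^+ 2).
  by rewrite mulr_ge0 //; [lra | rewrite subr_ge0 antipodal_sqr].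
(* Two nonnegative slacks with nonpositive sum both vanish: the first gives evenness, the second
   that [f x * f (- x)] is constant. *)
have /eqP : (s - (q - 2)) * (mass f ^+ 2 - antipodal f ^+ 2) = 0 by lra.
have /eqP : (q - 2) * (s * antipodal2 f - antipodal f ^+ 2) = 0 by lra.
have q2 : q - 2 != 0 by apply/eqP; lra.
rewrite !mulf_eq0 (negPf q2) (gt_eqF s0) /= !subr_eq0 => /eqP a2.
have m0 : 0 <= mass f by apply: sumr_ge0 => x _; apply: sqr_ge0.
have a0 : 0 <= antipodal f by apply: sumr_ge0 => x _; apply: mulr_ge0.
rewrite eqrXn2 // => /eqP am.
have even x : x \in C -> f x = f (- x).
  move=> hx; have := mass_antipodal f; rewrite am subrr mulr0 => h0.
  have := psumr_eq0P (fun x _ => sqr_ge0 (f x - f (- x))) h0 hx.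
  by move=> /eqP; rewrite sqrf_eq0 subr_eq0 => /eqP.
have prod : (\sum_(x in C) f x * f (- x)) ^+ 2 = (\sum_(x in C) 1) * \sum_(x in C) (f x * f (- x)) ^+ 2.
  rewrite sum_cone1 -/(antipodal f) -a2; congr (_ * _).
  by apply: eq_bigr => x _; rewrite exprMn.
move=> x y hx hy; have := sqr_sum_eq prod hx hy.
rewrite -!even // -!expr2 => /eqP; rewrite eqrXn2 // => /eqP //.
Qed.

End Nonnegative.

(** Each part of [energy_split] is evaluated exactly, the transverse one as the complement of the
    radial one. *)
Lemma energy_cst (r : R) : s * energy (fun=> r) = lambda * mass (fun=> r) ^+ 2.
Proof.
set f := fun=> r : R.
have cst (P : pred V) (c : R) : \sum_(x | P x) c = (\sum_(x | P x) 1) * c.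
  by rewrite mulr_suml; apply: eq_bigr => x _; rewrite mul1r.
have massE : mass f = s * r ^+ 2 by rewrite /mass /f /= cst sum_cone1.
have antiE : antipodal f = s * r ^+ 2 by rewrite /antipodal /f /= cst sum_cone1 expr2.
have radE : radial f = s * ((q - 1) * r ^+ 4).
  rewrite /radial -sum_cone1 mulr_suml; apply: eq_bigr => x hx.
  by rewrite /f /= cst (card_line R charF symA ndA hx) mul1r -exprD.
have convE : \sum_(w in C) conv f w ^+ 2 = s * ((q - 2) ^+ 2 * r ^+ 4).
  rewrite -sum_cone1 mulr_suml; apply: eq_bigr => w hw.
  by rewrite /conv /f /= cst (card_cone_sub hw); ring.
rewrite energy_split antiE convE qsum_prod_cst // -/(transverse f).
have -> : transverse f = mass f ^+ 2 - radial f by rewrite mass_split addrC addKr.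
rewrite radE massE; ring.
Qed.

End Energy.

(** * From extension norms to energy *)

Section Fourier.
Variables (K : numClosedFieldType) (F : finFieldType) (chi : F -> K).
Hypotheses (chiD : forall a b, chi (a + b) = chi a * chi b)
  (chi1 : forall a, `|chi a| = 1) (chiN1 : exists a, chi a != 1).
Local Notation V := 'rV[F]_3.
Implicit Types (v w x : V) (h : V -> K).

Lemma dotpDl v w x : dotp (v + w) x = dotp v x + dotp w x.
Proof.
rewrite /dotp -big_split; apply: eq_bigr => i _.
by rewrite mxE mulrDl.
Qed.

Lemma dotpDr v w x : dotp x (v + w) = dotp x v + dotp x w.
Proof.
rewrite /dotp -big_split; apply: eq_bigr => i _.
by rewrite mxE mulrDr.
Qed.

Lemma dotpNl v x : dotp (- v) x = - dotp v x.
Proof. by rewrite /dotp -sumrN; apply: eq_bigr => i _; rewrite mxE mulNr. Qed.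

Lemma chi_neq0 a : chi a != 0.
Proof. by rewrite -normr_eq0 chi1 oner_neq0. Qed.

Lemma chi_0 : chi 0 = 1.
Proof. by apply: (mulfI (chi_neq0 0)); rewrite -chiD addr0 mulr1. Qed.

Lemma chi_conj a : ((chi a)^*)%R = chi (- a).
Proof.
apply: (mulfI (chi_neq0 a)).
by rewrite -normCK chi1 expr1n -chiD subrr chi_0.
Qed.

Lemma chi_orthogonality v :
  \sum_x chi (dotp v x) = if v == 0 then #|F|%:R ^+ 3 else 0.
Proof.
case: eqP => [->|/eqP v0].
  rewrite (eq_bigr (fun=> 1)) => [|x _].
    by rewrite sumr_const card_mx mul1n natrX.
  by rewrite /dotp big1 ?chi_0 // => i _; rewrite mxE mul0r.
have [a ha] := chiN1; have [i vi] : exists i, v 0 i != 0.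
  apply/existsP; apply: contraNT v0 => /existsPn h; apply/eqP/rowP => i.
  by rewrite mxE; apply/eqP; rewrite -[_ == _]negbK h.
(* Scaled so that [dotp v y = a]: translation by [y] then multiplies the sum by [chi a], which is
   not [1]. *)
pose y : V := (a / v 0 i) *: delta_mx 0 i.
have vy : dotp v y = a.
  rewrite /dotp (bigD1 i) //= big1 => [|j ji]; rewrite !mxE ?eqxx /=.
    by rewrite addr0 mulr1 mulrC mulfVK.
  by rewrite (negPf ji) !mulr0.
have E : \sum_x chi (dotp v x) = chi a * \sum_x chi (dotp v x).
  rewrite mulr_sumr [LHS](reindex_inj (addrI y)) /=; apply: eq_bigr => x _.
  by rewrite dotpDr vy chiD.
apply/eqP; move/eqP: E; rewrite -subr_eq0 -[X in X - _]mul1r -mulrBl mulf_eq0.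
by rewrite subr_eq0 eq_sym (negPf ha).
Qed.

Lemma parseval h : \sum_x `|\sum_v h v * chi (dotp v x)| ^+ 2
  = #|F|%:R ^+ 3 * \sum_v `|h v| ^+ 2.
Proof.
transitivity (\sum_x \sum_v \sum_w h v * ((h w)^*)%R * chi (dotp (v - w) x)).
  apply: eq_bigr => x _; rewrite normCK rmorph_sum mulr_suml.
  apply: eq_bigr => v _; rewrite mulr_sumr; apply: eq_bigr => w _.
  by rewrite rmorphM /= chi_conj dotpDl dotpNl chiD; ring.
rewrite exchange_big mulr_sumr; apply: eq_bigr => v _.
rewrite exchange_big (bigD1 v) //= [X in _ + X]big1 => [|w wv].
  by rewrite -mulr_sumr subrr chi_orthogonality eqxx addr0 normCK mulrC.
by rewrite -mulr_sumr chi_orthogonality subr_eq0 eq_sym (negPf wv) mulr0.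
Qed.

Definition cconv (S : {set V}) h w : K := \sum_(x in S | w - x \in S) h x * h (w - x).

(** Squaring turns the sum into the transform of a convolution, so the fourth power falls under
    Parseval. *)
Lemma sqr_trig_sum (S : {set V}) h x : (\sum_(v in S) h v * chi (dotp v x)) ^+ 2
  = \sum_w cconv S h w * chi (dotp w x).
Proof.
rewrite expr2 mulr_suml.
under [RHS]eq_bigr => w _ do rewrite /cconv mulr_suml.
rewrite (exchange_big_dep (fun v => v \in S)) /=; last by move=> w v _ /andP[].
apply: eq_bigr => v hv; rewrite mulr_sumr.
rewrite [RHS](reindex_inj (addrI v)) /=; apply: eq_big => w.
  by rewrite [v + w]addrC addrK hv.
by move=> _; rewrite [v + w - v]addrC addKr dotpDl chiD; ring.
Qed.

Lemma sum_trig_pow4 (S : {set V}) h :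
  \sum_x `|\sum_(v in S) h v * chi (dotp v x)| ^+ 4
  = #|F|%:R ^+ 3 * \sum_w `|cconv S h w| ^+ 2.
Proof.
rewrite -parseval; apply: eq_bigr => x _.
by rewrite -sqr_trig_sum normrX -exprM.
Qed.
End Fourier.

(** * The extension inequality, its sharpness and its maximizers *)

Section ConeExtension.
Variables (R : realType) (F : finFieldType) (chi : F -> R[i]) (A : 'M[F]_3).
Hypotheses (charF : 2%N \notin [pchar F]) (hchi : nontrivial_character chi).
Hypotheses (symA : A^T = A) (ndA : A \in unitmx).
Local Notation V := 'rV[F]_3.
Local Notation C := (cone A).
Local Notation q := (#|F|%:R : R).
Local Notation s := (q ^+ 2 - 1).
Implicit Types f : {x | x \in C} -> R[i].

(** Extension by zero, so that [f] can be evaluated at differences [w - x]. *)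
Definition extend0 f (v : V) : R[i] := oapp f 0 (insub v).

Lemma extend0E f xi : extend0 f (val xi) = f xi.
Proof. by rewrite /extend0 valK. Qed.

(* The norm of [R[i]] takes values in [R[i]]; this is its real value. *)
Definition modulus (z : R[i]) : R := complex.Re `|z|.

Lemma modulusE z : (modulus z)%:C = `|z|.
Proof. by rewrite RRe_real // normr_real. Qed.

Lemma modulus_ge0 z : 0 <= modulus z.
Proof. by rewrite -lecR modulusE rmorph0. Qed.

Lemma s_neq0 : s != 0.
Proof.
have q3 := card_ge3 R charF.
have -> : s = (q - 1) * (q + 1) by ring.
by rewrite mulf_neq0 //; apply/eqP; lra.
Qed.

(** The factor [s ^+ 4] comes from the normalized measure, [q ^+ 3] from Parseval. *)
Lemma L4norm_extension f : L4norm (extension chi f) ^+ 4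
  = (q ^+ 3 / s ^+ 4)%:C * \sum_w `|cconv C (extend0 f) w| ^+ 2.
Proof.
have [chiD chi1 chiN1] := hchi.
rewrite /L4norm rootCK //.
have -> : (q ^+ 3 / s ^+ 4)%:C = (#|C|%:R ^+ 4)^-1 * #|F|%:R ^+ 3.
  rewrite -(card_cone R charF symA ndA) rmorphM rmorphXn fmorphV rmorphXn !rmorph_nat.
  by rewrite mulrC.
rewrite -mulrA -(sum_trig_pow4 chiD chi1 chiN1) mulr_sumr; apply: eq_bigr => x _.
rewrite /extension normrM exprMn normfV normr_nat exprVn; congr (_ * `|_| ^+ 4).
by rewrite [RHS]big_sub; apply: eq_bigr => xi _; rewrite extend0E.
Qed.

Lemma L2norm_pow4 f : L2norm f ^+ 4
  = (mass A (modulus \o extend0 f) ^+ 2 / s ^+ 2)%:C.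
Proof.
rewrite -[4%N]/(2 * 2)%N exprM rootCK // exprMn mulrC rmorphM fmorphV !rmorphXn.
rewrite -(card_cone R charF symA ndA) rmorph_nat exprVn; congr (_ ^+ 2 / _).
rewrite /mass rmorph_sum [RHS]big_sub; apply: eq_bigr => xi _.
by rewrite /= rmorphXn /= modulusE extend0E.
Qed.

(** The triangle inequality; it reduces the bound to nonnegative functions. *)
Lemma norm_cconv_le f w :
  `|cconv C (extend0 f) w| <= (conv A (modulus \o extend0 f) w)%:C.
Proof.
rewrite (le_trans (ler_norm_sum _ _ _)) // rmorph_sum /=.
by apply: ler_sum => x _; rewrite normrM rmorphM /= !modulusE.
Qed.

Lemma sum_cconv_le f : \sum_w `|cconv C (extend0 f) w| ^+ 2
  <= (energy A (modulus \o extend0 f))%:C.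
Proof.
rewrite rmorph_sum /=; apply: ler_sum => w _; rewrite rmorphXn /=.
by rewrite lerXn2r ?nnegrE ?norm_cconv_le // (le_trans _ (norm_cconv_le f w)).
Qed.

Lemma cone_constantE : cone_constant R A
  = q ^+ 3 / s ^+ 2 * ((s * (q + 1) - (3 * q - 4)) / s).
Proof.
rewrite /cone_constant (card_cone R charF symA ndA); congr (_ * _).
by rewrite [RHS]mulrBl [s * _]mulrC mulfK ?s_neq0.
Qed.

Lemma L2norm_bound f : (cone_constant R A)%:C * L2norm f ^+ 4
  = (q ^+ 3 / s ^+ 4)%:C
    * ((s * (q + 1) - (3 * q - 4)) * mass A (modulus \o extend0 f) ^+ 2 / s)%:C.
Proof.
rewrite L2norm_pow4 cone_constantE -!rmorphM; congr (_%:C).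
by field; exact: s_neq0.
Qed.

Lemma s_gt0 : 0 < s.
Proof. by have := card_cone_gt R charF; have := card_ge3 R charF; lra. Qed.

Lemma factor_gt0 : 0 < q ^+ 3 / s ^+ 4.
Proof.
have := card_ge3 R charF => q3.
by rewrite divr_gt0 ?exprn_gt0 ?s_gt0 //; lra.
Qed.

Lemma extension_le f : L4norm (extension chi f) ^+ 4
  <= (cone_constant R A)%:C * L2norm f ^+ 4.
Proof.
rewrite L4norm_extension L2norm_bound ler_pM2l ?ltcR ?factor_gt0 //.
rewrite (le_trans (sum_cconv_le f)) // lecR ler_pdivlMr ?s_gt0 // mulrC.
by apply: energy_le => // x; apply: modulus_ge0.
Qed.

(** For a constant [z] all terms of a convolution equal [z * z], so passing to the modulus loses
    nothing. *)
Lemma extension_cst f z : (forall xi, f xi = z) ->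
  L4norm (extension chi f) ^+ 4 = (cone_constant R A)%:C * L2norm f ^+ 4.
Proof.
move=> fz; rewrite L4norm_extension L2norm_bound; congr (_ * _).
have hz v : v \in C -> extend0 f v = z.
  by move=> hv; rewrite -[v]/(val (Sub v hv : {x | x \in C})) extend0E fz.
have -> : mass A (modulus \o extend0 f) = mass A (fun=> modulus z).
  by apply: eq_bigr => v hv; rewrite /= hz.
rewrite -(energy_cst charF symA ndA) [s * _ / _]mulrAC divff ?s_neq0 // mul1r rmorph_sum.
apply: eq_bigr => w _; rewrite rmorphXn /=; congr (_ ^+ 2).
have -> : cconv C (extend0 f) w = \sum_(x in C | w - x \in C) z * z.
  by apply: eq_bigr => x /andP[hx hwx]; rewrite !hz.
by rewrite /conv !sumr_const normrMn normrM rmorphMn rmorphM /= modulusE.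
Qed.

(** The energy of [|f|] lies between the convolution sum of [f] and the sharp bound; equality of
    these outer two makes [|f|] extremal. *)
Lemma maximizer_modulus f : maximizer chi f -> exists r : R[i], forall xi, `|f xi| = r.
Proof.
move=> [_]; rewrite L4norm_extension L2norm_bound => h.
have {}h := mulfI (lt0r_neq0 (etrans (ltcR _ _) factor_gt0 : 0 < (_)%:C)) h.
have := sum_cconv_le f; rewrite h lecR ler_pdivrMr ?s_gt0 // [energy _ _ * _]mulrC => le1.
have f0 v : 0 <= (modulus \o extend0 f) v by apply: modulus_ge0.
have e : s * energy A (modulus \o extend0 f)
    = (s * (q + 1) - (3 * q - 4)) * mass A (modulus \o extend0 f) ^+ 2.
  by apply/eqP; rewrite eq_le le1 energy_le.
have [v0 hv0] := cone_nonempty charF symA.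
exists (modulus (extend0 f v0))%:C => -[v hv].
rewrite -modulusE -(extend0E f); congr (_%:C).
exact: (energy_eq charF symA ndA f0 e (valP (Sub v hv : {x | x \in C})) hv0).
Qed.

Lemma L2norm_one : L2norm (fun _ : {x | x \in C} => 1 : R[i]) ^+ 4 = 1.
Proof.
rewrite L2norm_pow4 (_ : mass _ _ = s) ?divff ?rmorph1 ?expf_neq0 ?s_neq0 //.
rewrite -(sum_cone1 R charF symA ndA); apply: eq_bigr => v hv.
rewrite /= -[v]/(val (Sub v hv : {x | x \in C})) extend0E.
by rewrite /modulus normr1 expr1n.
Qed.

End ConeExtension.

Theorem theorem1p4 (R : realType) (F : finFieldType)
    (charF : 2%N \notin [pchar F])
    (chi : F -> R[i]) (hchi : nontrivial_character chi)
    (A : 'M[F]_3) (symA : A^T = A) (ndA : A \in unitmx) :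
  [/\ forall f : {x | x \in cone A} -> R[i],
        L4norm (extension chi f) ^+ 4
          <= (cone_constant R A)%:C * L2norm f ^+ 4,
      forall c : R,
        (forall f : {x | x \in cone A} -> R[i],
           L4norm (extension chi f) ^+ 4 <= c%:C * L2norm f ^+ 4) ->
        cone_constant R A <= c,
      forall f : {x | x \in cone A} -> R[i],
        (exists z : R[i], forall xi, f xi = z) ->
        L4norm (extension chi f) ^+ 4
          = (cone_constant R A)%:C * L2norm f ^+ 4
    & forall f : {x | x \in cone A} -> R[i],
        maximizer chi f ->
        exists r : R[i], forall xi, `|f xi| = r].
Proof.
split.
- exact: extension_le.
(* Sharpness is tested on the constant [1], whose [L2norm] has fourth power [1]. *)
- move=> c /(_ (fun=> 1)); rewrite (extension_cst charF hchi symA ndA (z := 1)) //.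
  by rewrite L2norm_one // !mulr1 lecR.
- by move=> f [z fz]; exact: (extension_cst charF hchi symA ndA fz).
- exact: maximizer_modulus.
Qed.
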